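(* Let $n \ge 1$ and $c \geq 1$ be integers. There exists a finite ring $R$ of characteristic $c$ with $R^\times \cong \mathrm{Hol}(\mathbf{Z}_n)$ if and only if one of the following holds: - $c = 1$ and $n = 1$; - $c = 2$ and $n \in \{1, 2, 3, 4, 6, 12\}$; - $c = 3$ and $n \in \{2, 6\}$; - $c = 4$ and $n \in \{2, 4, 6, 12\}$; - $c = 6$ and $n \in \{2, 6\}$. Moreover, examples of finite rings of characteristic $c$ with unit group isomorphic to $\mathrm{Hol}(\mathbf{Z}_n)$ are as follows. For $c=1$: the zero ring ($n=1$). For $c=2$: $\mathbf{F}_2$ ($n=1$, $\mathrm{Hol}(\mathbf{Z}_1) = C_1$); $\mathbf{F}_2[x]/(x^2)$ ($n=2$, $\mathrm{Hol}(\mathbf{Z}_2) \cong C_2$); $M_2(\mathbf{F}_2)$ ($n=3$, $\mathrm{Hol}(\mathbf{Z}_3) \cong S_3 \cong D_6$); $U_3(\mathbf{F}_2)$ ($n=4$, $\mathrm{Hol}(\mathbf{Z}_4) \cong D_8$); the group ring $\mathbf{F}_2[D_6]$ ($n=6$, $\mathrm{Hol}(\mathbf{Z}_6) \cong D_{12}$); $U_3(\mathbf{F}_2) \times M_2(\mathbf{F}_2)$ ($n = 12$, $\mathrm{Hol}(\mathbf{Z}_{12}) \cong D_8 \times D_6$). For $c=3$: $\mathbf{F}_3$ ($n=2$); $U_2(\mathbf{F}_3)$ ($n=6$). For $c=4$: $\mathbf{Z}_4$ ($n=2$); $\mathrm{End}_{\mathbf{Z}}(C_4 \times C_2)$ ($n=4$);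 $\mathbf{Z}_4 \times M_2(\mathbf{F}_2)$ ($n=6$); $M_2(\mathbf{F}_2) \times \mathrm{End}_{\mathbf{Z}}(C_4\times C_2)$ ($n=12$). For $c=6$: $\mathbf{Z}_6$ ($n=2$); $\mathbf{F}_2 \times U_2(\mathbf{F}_3)$ ($n=6$).
   Context: Rings are associative with identity, not necessarily commutative; the zero ring is allowed (it has characteristic $1$ and trivial unit group). $R^\times$ is the group of units of $R$. $\mathbf{Z}_n$ is the cyclic group (or ring) of integers modulo $n$; $C_n$ is the cyclic group of order $n$; $S_n$ is the symmetric group of degree $n$; $D_n$ is the dihedral group of order $n$; $\mathbf{F}_q$ is the field with $q$ elements; $M_n(R)$ is the ring of $n\times n$ matrices over $R$; $U_n(R)$ is the ring of upper triangular matrices in $M_n(R)$; $\mathrm{End}_{\mathbf{Z}}(A)$ is the endomorphism ring of an abelian group $A$. The holomorph of a group $G$ is $\mathrm{Hol}(G) = G \rtimes \mathrm{Aut}(G)$ (with the natural action); thus $\mathrm{Hol}(\mathbf{Z}_n) = \mathbf{Z}_n \rtimes \mathbf{Z}_n^\times$ is the group of maps $x \mapsto ax+b$ on $\mathbf{Z}_n$ with $a \in \mathbf{Z}_n^\times$, $b \in \mathbf{Z}_n$. *)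

(* Defs.v *)
From HB Require Import structures.
From mathcomp Require Import all_boot all_order all_algebra.
From mathcomp Require Import all_fingroup all_solvable all_field.

Set Implicit Arguments.
Unset Strict Implicit.
Unset Printing Implicit Defensive.

Import GRing.Theory.
Local Open Scope ring_scope.

(* Rings may be zero, hence [finPzRingType] rather than [finNzRingType].      *)
Definition has_char (R : finPzRingType) (c : nat) : Prop :=
  [/\ (0 < c)%N, c%:R = 0 :> R &
      forall m : nat, (0 < m)%N -> m%:R = 0 :> R -> (c <= m)%N].

(* The library's {unit R} needs a nonzero ring, so the unit group is defined  *)
(* here for every finite ring.                                                *)
Section Units.

Variable R : finPzRingType.

Definition is_inverse (x y : R) := (x * y == 1) && (y * x == 1).
Definition invertible (x : R) := [exists y, is_inverse x y].

Inductive units : predArgType := Units (x : R) of invertible x.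
Definition units_val (u : units) : R := let: Units x _ := u in x.

HB.instance Definition _ := [isSub for units_val].
HB.instance Definition _ := [Finite of units by <:].

Lemma invertible1 : invertible 1.
Proof. by apply/existsP; exists 1; rewrite /is_inverse mulr1 eqxx. Qed.

Lemma invertibleM (u v : units) : invertible (val u * val v).
Proof.
have /existsP[x' /andP[/eqP xx' /eqP x'x]] := valP u.
have /existsP[y' /andP[/eqP yy' /eqP y'y]] := valP v.
apply/existsP; exists (y' * x'); rewrite /is_inverse !mulrA.
by rewrite -(mulrA (val u)) yy' mulr1 xx' -(mulrA y') x'x mulr1 y'y !eqxx.
Qed.

Lemma units_inverse_subproof (u : units) : exists y, is_inverse (val u) y.
Proof. by apply/existsP; case: u. Qed.

Definition units_inverse (u : units) : R := xchoose (units_inverse_subproof u).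

Lemma units_inverseP (u : units) : is_inverse (val u) (units_inverse u).
Proof. exact: xchooseP. Qed.

Lemma invertible_inverse (u : units) : invertible (units_inverse u).
Proof.
by apply/existsP; exists (val u); rewrite /is_inverse andbC; apply: units_inverseP.
Qed.

Definition units_one := Units invertible1.
Definition units_mul u v := Units (invertibleM u v).
Definition units_inv u := Units (invertible_inverse u).

Lemma units_mulA : associative units_mul.
Proof. by move=> u v w; apply/val_inj/mulrA. Qed.

Lemma units_mul1 : left_id units_one units_mul.
Proof. by move=> u; apply/val_inj/mul1r. Qed.

Lemma units_mulV : left_inverse units_one units_inv units_mul.
Proof. by move=> u; apply/val_inj; have /andP[_ /eqP] := units_inverseP u. Qed.

HB.instance Definition _ := Finite_isGroup.Build units
  units_mulA units_mul1 units_mulV.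

End Units.

Arguments units R%_type.
Notation "''U(' R )" := [set: units R]
  (at level 0, R at level 200, format "''U(' R )") : group_scope.

(* Hol(G) = G >< Aut(G): [aut_groupAction G] is the natural action of [Aut G] *)
(* on [G], and [sdprod_by] the external semidirect product.                   *)
Definition hol (gT : finGroupType) (G : {group gT}) : finGroupType :=
  sdprod_by (aut_groupAction G).

(* Zp n is the additive group Z/n, including the trivial group for n = 1      *)
(* (whereas the type 'Z_1 is Z/2).                                            *)
Notation "''Hol_' n" := [set: hol (Zp_group n)]
  (at level 0, n at level 2, format "''Hol_' n") : group_scope.

Section ZeroRing.

Let uadd (_ _ : unit) := tt.
Let uopp (_ : unit) := tt.

Fact unit_addA : associative uadd. Proof. by []. Qed.
Fact unit_addC : commutative uadd. Proof. by []. Qed.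
Fact unit_add0 : left_id tt uadd. Proof. by case. Qed.
Fact unit_addN : left_inverse tt uopp uadd. Proof. by case. Qed.
Fact unit_mul1l : left_id tt uadd. Proof. by case. Qed.
Fact unit_mul1r : right_id tt uadd. Proof. by case. Qed.
Fact unit_mulDl : left_distributive uadd uadd. Proof. by []. Qed.
Fact unit_mulDr : right_distributive uadd uadd. Proof. by []. Qed.

HB.instance Definition _ := GRing.isZmodule.Build unit
  unit_addA unit_addC unit_add0 unit_addN.
HB.instance Definition _ := GRing.Zmodule_isPzRing.Build unit
  unit_addA unit_mul1l unit_mul1r unit_mulDl unit_mulDr.

End ZeroRing.

HB.instance Definition _ (R S : finZmodType) := GRing.Zmodule.on (R * S)%type.
HB.instance Definition _ (R S : finPzRingType) := GRing.PzRing.on (R * S)%type.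

Section UpperTriangular.

Variables (R : finPzRingType) (n : nat).

Definition upper_pred : pred 'M[R]_n :=
  fun A => [forall i : 'I_n, forall j : 'I_n, (j < i)%N ==> (A i j == 0)].

Lemma upperP (A : 'M[R]_n) :
  reflect (forall i j : 'I_n, (j < i)%N -> A i j = 0) (upper_pred A).
Proof.
apply: (iffP forallP) => [uA i j ji | uA i].
  by have /forallP/(_ j)/implyP/(_ ji)/eqP := uA i.
by apply/forallP => j; apply/implyP => /uA ->.
Qed.

Fact upper_subring : subring_closed upper_pred.
Proof.
split=> [|A B /upperP uA /upperP uB|A B /upperP uA /upperP uB]; apply/upperP.
- by move=> i j ji; rewrite mxE -val_eqE /= gtn_eqF.
- by move=> i j ji; rewrite !mxE uA // uB // subrr.
move=> i j ji; rewrite mxE big1 // => k _.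
have [ki | ik] := ltnP k i; first by rewrite uA // mul0r.
by rewrite uB ?mulr0 // (leq_trans ji).
Qed.

Inductive upper : predArgType := Upper (A : 'M[R]_n) of upper_pred A.
Definition upper_val (u : upper) : 'M[R]_n := let: Upper A _ := u in A.

HB.instance Definition _ := [isSub for upper_val].
HB.instance Definition _ := [Finite of upper by <:].
HB.instance Definition _ :=
  GRing.SubChoice_isSubPzRing.Build 'M[R]_n upper_pred upper upper_subring.

End UpperTriangular.

Notation "''U_' n [ R ]" := (upper R n)
  (at level 0, n at level 2, format "''U_' n [ R ]") : type_scope.

Section GroupRing.

Variables (R : finPzRingType) (G : finGroupType).

Definition group_algebra : predArgType := {ffun G -> R}.

HB.instance Definition _ := Finite.on group_algebra.
HB.instance Definition _ := GRing.Zmodule.on group_algebra.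

Implicit Types f g h : group_algebra.

Definition galg_one : group_algebra := [ffun x => (x == 1%g)%:R].
Definition galg_mul f g : group_algebra :=
  [ffun x => \sum_y f y * g (y^-1 * x)%g].

Fact galg_mulA : associative galg_mul.
Proof.
move=> f g h; apply/ffunP => x; rewrite !ffunE.
under eq_bigr => y _ do rewrite ffunE big_distrr /=.
under [RHS]eq_bigr => z _ do rewrite ffunE big_distrl /=.
rewrite [RHS]exchange_big /=; apply: eq_bigr => y _.
rewrite [RHS](reindex_inj (mulgI y)) /=; apply: eq_bigr => z _.
by rewrite mulKg invMg !mulgA mulrA.
Qed.

Fact galg_mul1 : left_id galg_one galg_mul.
Proof.
move=> f; apply/ffunP => x; rewrite ffunE (bigD1 1%g) //= big1 => [|y y1].
  by rewrite ffunE eqxx mul1r invg1 mul1g addr0.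
by rewrite ffunE (negbTE y1) mul0r.
Qed.

Fact galg_mulr1 : right_id galg_one galg_mul.
Proof.
move=> f; apply/ffunP => x; rewrite ffunE (bigD1 x) //= big1 => [|y yx].
  by rewrite ffunE mulVg eqxx mulr1 addr0.
by rewrite ffunE -eq_mulVg1 (negbTE yx) mulr0.
Qed.

Fact galg_mulDl : left_distributive galg_mul +%R.
Proof.
move=> f g h; apply/ffunP => x; rewrite !ffunE -big_split /=.
by apply: eq_bigr => y _; rewrite ffunE mulrDl.
Qed.

Fact galg_mulDr : right_distributive galg_mul +%R.
Proof.
move=> f g h; apply/ffunP => x; rewrite !ffunE -big_split /=.
by apply: eq_bigr => y _; rewrite ffunE mulrDr.
Qed.

HB.instance Definition _ := GRing.Zmodule_isPzRing.Build group_algebra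
  galg_mulA galg_mul1 galg_mulr1 galg_mulDl galg_mulDr.

End GroupRing.

Section EndomorphismRing.

Variable A : finZmodType.

Definition additive_pred : pred {ffun A -> A} :=
  fun f => [forall x, forall y, f (x + y) == f x + f y].

Lemma additiveP (f : {ffun A -> A}) :
  reflect {morph f : x y / x + y} (additive_pred f).
Proof.
apply: (iffP forallP) => [fD x y | fD x]; first exact/eqP/(forallP (fD x)).
by apply/forallP => y; apply/eqP.
Qed.

Fact additive_zmod : zmod_closed additive_pred.
Proof.
split=> [|f g /additiveP fD /additiveP gD]; apply/additiveP => x y.
  by rewrite !ffunE addr0.
by rewrite !ffunE fD gD opprD addrACA.
Qed.

Inductive endo : predArgType := Endo (f : {ffun A -> A}) of additive_pred f.
Definition endo_val (u : endo) : {ffun A -> A} := let: Endo f _ := u in f.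

HB.instance Definition _ := [isSub for endo_val].
HB.instance Definition _ := [Finite of endo by <:].
HB.instance Definition _ :=
  GRing.SubChoice_isSubZmodule.Build {ffun A -> A} additive_pred endo
    additive_zmod.

Fact endo_one_subproof : additive_pred [ffun x : A => x].
Proof. by apply/additiveP => x y; rewrite !ffunE. Qed.

Fact endo_mul_subproof (u v : endo) :
  additive_pred [ffun x => val u (val v x)].
Proof.
apply/additiveP => x y.
by rewrite !ffunE (additiveP _ (valP v)) (additiveP _ (valP u)).
Qed.

Definition endo_one := Endo endo_one_subproof.
Definition endo_mul u v := Endo (endo_mul_subproof u v).

Fact endo_mulA : associative endo_mul.
Proof. by move=> u v w; apply/val_inj/ffunP => x; rewrite /= !ffunE. Qed.

Fact endo_mul1 : left_id endo_one endo_mul.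
Proof. by move=> u; apply/val_inj/ffunP => x; rewrite /= !ffunE. Qed.

Fact endo_mulr1 : right_id endo_one endo_mul.
Proof. by move=> u; apply/val_inj/ffunP => x; rewrite /= !ffunE. Qed.

Fact endo_mulDl : left_distributive endo_mul +%R.
Proof. by move=> u v w; apply/val_inj/ffunP => x; rewrite /= !ffunE. Qed.

Fact endo_mulDr : right_distributive endo_mul +%R.
Proof.
move=> u v w; apply/val_inj/ffunP => x.
by rewrite /= !ffunE (additiveP _ (valP u)).
Qed.

HB.instance Definition _ := GRing.Zmodule_isPzRing.Build endo
  endo_mulA endo_mul1 endo_mulr1 endo_mulDl endo_mulDr.

End EndomorphismRing.

Definition realizes_hol (R : finPzRingType) (c n : nat) : Prop :=
  has_char R c /\ ('U(R) \isog 'Hol_n)%g.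

(* Main.v *)
Require Import Defs.
From HB Require Import structures.
From mathcomp Require Import all_boot all_order all_algebra.
From mathcomp Require Import all_fingroup all_solvable all_field.
From mathcomp Require Import ring zify.

(* Translation by 1 in Hol(Z_n) generates a self-centralizing cyclic subgroup *)
(* of order n and is conjugate to its inverse.  Hence, if R^* = Hol(Z_n), a   *)
(* unit t of R of order n is such that every unit of R commuting with t is a  *)
(* power of t and is inverted by an inner automorphism sigma with             *)
(* sigma(t) = t^-1.  The bicommutant S of t is then a finite commutative ring *)
(* with unit group <t>.  If e is an idempotent power of 1 + t, then           *)
(* (1 + t)e + (1 - e) is a unit of S, and sigma fixes e; comparing it with its *)
(* image yields (1 + t^-1)(1 + t)e = e, that is, (t^2 + t + 1)(1 + t)^N = 0   *)
(* for some N.  Since <t> has at most one subgroup of each prime order,       *)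
(* nilpotent elements of S killed by 2 have cube 0 and those killed by 3 have *)
(* square 0, so t^12 = 1 in characteristic 2 or 4 and t^6 = 1 in              *)
(* characteristic 3 or 6.  The characteristic is restricted because an        *)
(* integer invertible in R is fixed by sigma, hence is 1 or -1.               *)
(* For the examples, unit groups are bounded by enumerating a computable copy *)
(* of the ring, and a group of order at most 2q containing x of order q > 2   *)
(* and an involution inverting x is dihedral.                                 *)

Set Implicit Arguments.
Unset Strict Implicit.
Unset Printing Implicit Defensive.

Import GroupScope.

(** * Holomorphs of cyclic groups *)

(** Necessity rests on two elements of Hol(Z_n): a self-centralizing translation t and an involution
    inverting it ([hol_inversion]). Carried over to R, they make the bicommutant S of t a finite
    commutative ring with unit group <t>, all of whose units are inverted by one inner automorphism
    of R ([conjy_unit]). This automorphism fixes integers, so for c > 2 every k prime to c is 1 or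
    -1 modulo c, which leaves few values of c ([char_central]). Applied to a unit built from 1 + t,
    it yields a polynomial equation for t ([bicent_equation]), which says that t is a root of unity
    of small order up to a nilpotent. A cyclic unit group leaves little room for nilpotents
    ([nilpotent_step]), so n divides 12 or 6 ([order_char4], [order_char3], [order_char6]); n is
    even for c > 2 because -1 is a power of t. For sufficiency, Hol(Z_n) is dihedral when n is 3, 4
    or 6 and is D_8 x D_6 when n = 12. The noncommutative examples are treated by
    [units_dihedral_model], which reduces the identification of a unit group to a finite
    computation, and by [units_prod_isog]. *)

Lemma cyclic_prime_order (gT : finGroupType) (G : {group gT}) (x y : gT) :
  cyclic G -> x \in G -> y \in G -> prime #[x] -> y ^+ #[x] = 1 -> y \in <[x]>.
Proof.
move=> cG Gx Gy px yx; have [->|y1] := eqVneq y 1; first exact: group1.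
have oy : #[y] = #[x] by apply: nt_prime_order.
suff /eqP-> : <[x]> == <[y]> by rewrite cycle_id.
by rewrite (eq_subG_cyclic cG) ?cycle_subG // -!orderE oy.
Qed.

(** As q > 2, x differs from its inverse, so y is outside the abelian group <x> and the generated
    group has at least 2q elements; the dihedral presentation makes it a quotient of ['D_(q.*2)]. *)
Lemma dihedral_gen (gT : finGroupType) (x y : gT) q :
    2 < q -> #[x] = q -> y ^+ 2 = 1 -> x ^ y = x^-1 ->
  <<[set x; y]>> \isog 'D_(q.*2).
Proof.
move=> q2 ox y2 xy; set D := <<[set x; y]>>.
have [Dx Dy] : x \in D /\ y \in D by rewrite !mem_gen ?set21 ?set22.
have nxy : y \notin <[x]>.
  apply/negP=> /cycleP[k yk]; suff: #[x] %| 2 by move/dvdn_leq; rewrite ox; lia.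
  have /conjg_fixP xyx : [~ x, y] == 1.
    by apply/commgP; rewrite yk; apply: commuteX.
  by rewrite order_dvdn expgS expg1 -{2}xyx xy mulgV.
have oD : q.*2 <= #|D|.
  have sxD : <[x]> \subset D by rewrite cycle_subG.
  rewrite -(Lagrange sxD) -orderE ox -muln2 leq_mul2l; apply/orP; right.
  rewrite indexg_gt1; apply: contra nxy => sDx; exact: (subsetP sDx).
rewrite isogEcard card_dihedral ?oD ?andbT; last by lia.
rewrite Grp_dihedral; last by lia.
apply/existsP; exists (x, y); rewrite /= !xpair_eqE y2 xy joing_idl joing_idr.
by rewrite -ox expg_order !eqxx.
Qed.

Lemma dihedral_isog (gT : finGroupType) (G : {group gT}) (x y : gT) q :
    2 < q -> x \in G -> y \in G -> #[x] = q -> y ^+ 2 = 1 -> x ^ y = x^-1 ->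
  #|G| <= q.*2 -> G \isog 'D_(q.*2).
Proof.
move=> q2 Gx Gy ox y2 xy leG; have isoD := dihedral_gen q2 ox y2 xy.
suff <- : <<[set x; y]>> = G by [].
apply/eqP; rewrite eqEcard gen_subG subUset !sub1set Gx Gy /=.
by rewrite (card_isog isoD) card_dihedral //; lia.
Qed.

Lemma cycle_power_aut (gT : finGroupType) (g : gT) k : coprime #[g] k ->
  exists2 a, a \in Aut <[g]> & a g = g ^+ k.
Proof.
move=> ck; have inj_k : 'injm (cyclem k g).
  apply/injmP => x y gx gy /eqP; rewrite /= /cyclem => xy.
  have gxy : x * y^-1 \in <[g]> by rewrite groupM ?groupV.
  apply/eqP; rewrite eq_mulgV1 -order_eq1 -dvdn1 -(eqP ck) dvdn_gcd order_dvdG //.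
  rewrite order_dvdn expgMn ?expgVn -?eq_mulgV1 //.
  by apply: (centsP (cycle_abelian g)); rewrite ?groupV.
have im_k : cyclem k g @* <[g]> = <[g]>.
  by apply/morphim_fixP => //; rewrite morphim_cycle ?cycle_id ?cycleX.
by exists (aut inj_k im_k); rewrite ?Aut_aut // autE ?cycle_id.
Qed.

Lemma Zp_cyclic n : cyclic (Zp n).
Proof.
rewrite /Zp; case: ifP => _; last exact: cyclic1.
by apply/cyclicP; exists Zp1; apply: Zp_cycle.
Qed.

(** For the centralizer: if u a commutes with t, where u is a translation and a comes from an
    automorphism, then a fixes a generator of Z_n, so a = 1. *)
Lemma hol_structure n : 0 < n ->
  exists (t : hol (Zp_group n)) (A : {group hol (Zp_group n)}),
  [/\ #[t] = n, <[t]> ><| A = 'Hol_n, 'C[t] = <[t]>, abelian A &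
      forall k, coprime n k -> exists2 y, y \in A & t ^ y = t ^+ k].
Proof.
move=> n0; set to := aut_groupAction (Zp_group n).
have [g Cg] : exists g, Zp_group n = <[g]> :> {set _}.
  exact/cyclicP/Zp_cyclic.
have og : #[g] = n by rewrite orderE -Cg /= card_Zp.
have gC : g \in Zp_group n by rewrite Cg cycle_id.
exists (sdpair1 to g), (sdpair2 to @* Aut (Zp_group n))%G.
have im1 : <[sdpair1 to g]> = sdpair1 to @* Zp_group n.
  by rewrite -morphim_cycle // -Cg.
have sdG := sdprod_sdpair to.
split.
- by rewrite (order_injm (injm_sdpair1 _)).
- by rewrite im1.
- apply/eqP; rewrite eqEsubset andbC cycle_subG cent1id /=.
  apply/subsetP => h /cent1P ch.
  have := in_setT h; rewrite -(sdprodW sdG) -im1 => /mulsgP[u v tu].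
  move=> /morphimP[a _ Aa ->{v}] hE; rewrite hE.
  suff -> : a = 1 by rewrite morph1 mulg1.
  have ta : sdpair1 to g ^ sdpair2 to a = sdpair1 to g.
    have -> : sdpair2 to a = u^-1 * h by rewrite hE mulKg.
    apply/conjg_fixP/commgP/commuteM => //; apply/commuteV.
    by have /cycleP[k ->] := tu; apply: commuteX.
  have ga : a g = g.
    apply: (injmP (injm_sdpair1 to)); rewrite ?Aut_closed //.
    exact: etrans (sdpair_act to gC Aa) ta.
  apply: (eq_Aut Aa (group1 _)) => x; rewrite Cg => /cycleP[k ->].
  by rewrite perm1 -(autmE Aa) morphX //= autmE ga.
- apply: morphim_abelian; apply: Aut_cyclic_abelian; exact: Zp_cyclic.
move=> k ck.
have [a Aa ag] : exists2 a, a \in Aut (Zp_group n) & a g = g ^+ k.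
  by rewrite Cg; apply: cycle_power_aut; rewrite og.
exists (sdpair2 to a); first by rewrite mem_morphim.
by rewrite -sdpair_act //= -morphX // -ag.
Qed.

Lemma card_hol n : 0 < n -> #|'Hol_n| = (n * totient n)%N.
Proof.
move=> n0; have G := sdprod_sdpair (aut_groupAction (Zp_group n)).
rewrite -(sdprod_card G) !card_injm ?injm_sdpair1 ?injm_sdpair2 //=.
by rewrite card_Aut_cyclic ?Zp_cyclic //= card_Zp.
Qed.

Lemma hol_inversion n : 0 < n -> exists t y : hol (Zp_group n),
  [/\ #[t] = n, 'C[t] = <[t]>, y ^+ 2 = 1 & t ^ y = t^-1].
Proof.
move=> n0; have [t [A [ot sdG Ct _ tA]]] := hol_structure n0.
(* The exponent n - 1 stands for -1; it is 0 when n = 1. *)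
have [|y Ay ty] := tA n.-1; first by rewrite coprimenP.
have tV : t ^ y = t^-1.
  have tn : t ^+ n = 1 by apply/eqP; rewrite -order_dvdn ot.
  by rewrite ty; apply/eqP; rewrite eq_sym eq_invg_mul -expgS prednK // tn.
(* The square of y centralizes t, so it lies in the trivial intersection of <t> and A. *)
exists t, y; split => //; have [_ _ _ tiA] := sdprodP sdG.
apply/set1gP; rewrite -tiA inE (groupX 2 Ay) andbT -Ct; apply/cent1P.
by apply/esym/commgP/conjg_fixP; rewrite expgS expg1 conjgM tV conjVg tV invgK.
Qed.

Lemma hol_dihedral n : 2 < n -> totient n = 2 -> 'Hol_n \isog 'D_(n.*2).
Proof.
move=> n2 phi_n; have n0 : 0 < n by lia.
have [t [y [ot _ y2 ty]]] := hol_inversion n0.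
by apply: (dihedral_isog n2 (in_setT t) (in_setT y));
  rewrite ?card_hol ?phi_n ?muln2.
Qed.

(** This is the splitting of Z_12 into Z_4 and Z_3. Since 7 is -1 modulo 4 and 1 modulo 3, [y7]
    inverts t^3 and fixes t^4; [y5] does the reverse. *)
Lemma hol12_isog : 'Hol_12 \isog setX 'D_8 'D_6.
Proof.
have [t [A [ot sdG Ct abA tA]]] := @hol_structure 12 isT.
have [y5 Ay5 ty5] := tA 5 isT; have [y7 Ay7 ty7] := tA 7 isT.
have [_ defG _ tiA] := sdprodP sdG.
have t12 : t ^+ 12 = 1 by apply/eqP; rewrite -order_dvdn ot.
have yP k y : y \in A -> t ^ y = t ^+ k -> k ^ 2 = 1 %[mod 12] -> y ^+ 2 = 1.
  move=> Ay ty k2; apply/set1gP; rewrite -tiA inE (groupX 2 Ay) andbT -Ct.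
  apply/cent1P/esym/commgP/conjg_fixP.
  rewrite expgS expg1 conjgM ty conjXg ty -expgM; apply/eqP.
  by rewrite -[X in _ == X]expg1 eq_expg_mod_order ot; apply/eqP.
have cyy : commute y5 y7 by apply: (centsP abA).
have t_mod i j : i = j %[mod 12] -> t ^+ i = t ^+ j.
  by move=> ij; apply/eqP; rewrite eq_expg_mod_order ot; apply/eqP.
have conj_t y k i j :
    t ^ y = t ^+ k -> i * k = j %[mod 12] -> (t ^+ i) ^ y = t ^+ j.
  by move=> ty ij; rewrite conjXg ty -expgM mulnC (t_mod _ j).
pose H := <<[set t ^+ 3; y7]>>%G; pose K := <<[set t ^+ 4; y5]>>%G.
have [Ha Hb] : t ^+ 3 \in H /\ y7 \in H by rewrite !mem_gen ?set21 ?set22.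
have [Ka Kb] : t ^+ 4 \in K /\ y5 \in K by rewrite !mem_gen ?set21 ?set22.
have cHK : H \subset 'C(K).
  rewrite cent_gen gen_subG; apply/subsetP=> h Hh; apply/centP => k Kk.
  move: Hh Kk; rewrite !inE => /orP[]/eqP-> /orP[]/eqP->.
  - exact/commuteX/commute_sym/commuteX.
  - exact/commgP/conjg_fixP/(conj_t _ _ _ _ ty5).
  - exact/commute_sym/commgP/conjg_fixP/(conj_t _ _ _ _ ty7).
  exact: commute_sym.
have tV i : i <= 12 -> (t ^+ i)^-1 = t ^+ (12 - i).
  by move=> i12; apply/eqP; rewrite eq_invg_mul -expgD subnKC // t12.
have isoH : H \isog 'D_8.
  apply: (@dihedral_gen _ _ _ 4) => //; first by rewrite orderXdiv ot.
    exact: (yP 7).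
  by rewrite (conj_t _ _ _ 9 ty7) // tV.
have isoK : K \isog 'D_6.
  apply: (@dihedral_gen _ _ _ 3) => //; first by rewrite orderXdiv ot.
    exact: (yP 5).
  by rewrite (conj_t _ _ _ 8 ty5) // tV.
have oH : #|H| = 8 by rewrite (card_isog isoH) (@card_dihedral 4).
have oK : #|K| = 6 by rewrite (card_isog isoK) (@card_dihedral 3).
(* The intersection contains t^4, of order 3, and is not all of K because [y5] does not commute with
   t. *)
have oKt : #|K :&: <[t]>| %| 3.
  have t4 : <[t ^+ 4]> \subset K :&: <[t]> by rewrite cycle_subG inE Ka mem_cycle.
  have := cardSg t4; have := cardSg (subsetIl K <[t]>).
  rewrite -orderE orderXdiv ot // oK.
  have y5t : y5 \notin <[t]>.
    apply/negP; rewrite -Ct => /cent1P/esym/commgP/conjg_fixP; rewrite ty5 => /eqP.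
    by rewrite -[X in _ == X]expg1 eq_expg_mod_order ot.
  have n6 : #|K :&: <[t]>| != 6.
    apply: contra y5t => /eqP o6; suff : y5 \in K :&: <[t]> by case/setIP.
    suff -> : K :&: <[t]> = K by [].
    by apply/eqP; rewrite eqEcard subsetIl o6 oK.
  move=> d6 d3; move: (@dvdn_leq _ 6 isT d6); move: n6 d6 d3.
  by case: #|_| => [|[|[|[|[|[|[|]]]]]]].
(* A common element commutes with t^3 and t^4, hence with t, so it lies in <t>; its order then
   divides both 8 and 3. *)
have tiHK : H :&: K = 1.
  apply/trivgP/subsetP => z /setIP[Hz Kz].
  have zt : z \in <[t]>.
    rewrite -Ct; apply/cent1P.
    have -> : t = (t ^+ 4) * (t ^+ 3)^-1 by rewrite expgS mulgK.
    apply: commuteM; last apply: commuteV.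
      exact: (centsP cHK).
    exact/commute_sym/(centsP cHK).
  rewrite inE -order_eq1 -dvdn1; suff: #[z] %| gcdn 8 3 by [].
  have z8 : #[z] %| 8 by move: (order_dvdG Hz); rewrite oH.
  rewrite dvdn_gcd z8 (dvdn_trans _ oKt) // order_dvdG //.
  by rewrite inE Kz.
have HK : H \x K = 'Hol_12.
  rewrite dprodE // 1?centsC //; apply/eqP; rewrite eqEcard subsetT card_hol //.
  by rewrite TI_cardMg // oH oK.
have D86 := setX_dprod [set: 'D_8]%G [set: 'D_6]%G.
apply: (isog_dprod HK D86).
  apply: (isog_trans isoH); exact: isog_setX1.
apply: (isog_trans isoK); exact: isog_set1X.
Qed.

Import GRing.Theory.
Local Open Scope ring_scope.

(** * Finite rings whose unit group is cyclic *)

Section DoubleCentralizer.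

Variables (R : finPzRingType) (t : R).

Definition bicent_pred : pred R :=
  fun x => [forall y, (y * t == t * y) ==> (x * y == y * x)].

Lemma bicentP x :
  reflect (forall y, y * t = t * y -> x * y = y * x) (bicent_pred x).
Proof.
apply: (iffP forallP) => [cx y yt | cx y].
  by have /implyP/(_ _)/eqP -> := cx y; rewrite ?yt.
by apply/implyP => /eqP yt; apply/eqP/cx.
Qed.

Fact bicent_subring : subring_closed bicent_pred.
Proof.
split=> [|a b /bicentP ca /bicentP cb|a b /bicentP ca /bicentP cb].
- by apply/bicentP => y _; rewrite mulr1 mul1r.
- by apply/bicentP => y yt; rewrite mulrBl mulrBr ca // cb.
by apply/bicentP => y yt; rewrite mulrA -ca // -!mulrA cb.
Qed.

Inductive bicent : predArgType := Bicent (x : R) of bicent_pred x.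
Definition bicent_val (u : bicent) : R := let: Bicent x _ := u in x.

HB.instance Definition _ := [isSub for bicent_val].
HB.instance Definition _ := [Finite of bicent by <:].
HB.instance Definition _ :=
  GRing.SubChoice_isSubPzRing.Build R bicent_pred bicent bicent_subring.

Fact bicent_gen_subproof : bicent_pred t.
Proof. by apply/bicentP => y ->. Qed.

Definition bicent_gen := Bicent bicent_gen_subproof.

Lemma bicent_comm (u : bicent) : val u * t = t * val u.
Proof. by have /bicentP -> := valP u. Qed.

(** An element v of the bicommutant commutes with t, so u commutes with it by definition. *)
Fact bicent_mulC : commutative (@GRing.mul bicent).
Proof.
move=> u v; apply: val_inj.
by have /bicentP := valP u; apply; apply: bicent_comm.
Qed.

HB.instance Definition _ := GRing.PzRing_hasCommutativeMul.Build bicent bicent_mulC.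

End DoubleCentralizer.

(** By the pigeonhole principle the powers of a are periodic from some index i on; an exponent that
    is at least i and a multiple of the period gives an idempotent. Divisibility by n lets the same
    exponent kill a unit of order n. *)
Lemma pow_idempotent (R : finPzRingType) (a : R) n : (0 < n)%N ->
  exists N, [/\ (0 < N)%N, (n %| N)%N & a ^+ N * a ^+ N = a ^+ N].
Proof.
move=> n0.
have /injectivePn[i [j +]] : ~~ injectiveb (fun k : 'I_#|R|.+1 => a ^+ k).
  by apply/negP => /injectiveP/leq_card; rewrite card_ord ltnn.
wlog ij : i j / (i < j)%N.
  move=> wlt nij aij; case: (ltngtP i j) nij => [/wlt|/wlt|/val_inj->]; last first.
  - by rewrite eqxx.
  - by move=> H nij; apply: (H); rewrite 1?eq_sym.
  by move=> H nij; apply: H nij aij.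
move=> _ aij; pose p := (j - i)%N.
have p0 : (0 < p)%N by rewrite subn_gt0.
have step k m : (i <= k)%N -> a ^+ (k + m * p) = a ^+ k.
  move=> ik; elim: m => [|m IH]; first by rewrite addn0.
  rewrite -IH (_ : k + m.+1 * p = j + (k - i + m * p))%N; last by lia.
  by rewrite [in RHS](_ : k + m * p = i + (k - i + m * p))%N ?exprD ?aij //; lia.
exists (p * n * i.+1)%N; split; rewrite ?muln_gt0 ?p0 ?n0 //.
  by rewrite mulnAC dvdn_mull.
rewrite -exprD {2}[(p * n * _)%N](_ : _ = (n * i.+1) * p)%N; last by lia.
by apply: step; nia.
Qed.

Section UnitPowers.

Variable R : finPzRingType.

Lemma val_unitX (u : units R) k : val (u ^+ k)%g = val u ^+ k.
Proof. by elim: k => // k IH; rewrite expgS exprS -IH. Qed.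

Lemma val_unitV (u : units R) : val (u^-1)%g * val u = 1.
Proof. by have /andP[_ /eqP] := units_inverseP u. Qed.

Lemma val_unitVr (u : units R) : val u * val (u^-1)%g = 1.
Proof. by have /andP[/eqP] := units_inverseP u. Qed.

Lemma invertibleP (x y : R) : x * y = 1 -> y * x = 1 -> invertible x.
Proof.
by move=> xy yx; apply/existsP; exists y; rewrite /is_inverse xy yx !eqxx.
Qed.

Lemma has_char_eq0 c m : has_char R c -> (m%:R == 0 :> R) = (c %| m)%N.
Proof.
move=> [c0 cR cmin]; have mE : m%:R = (m %% c)%:R :> R.
  by rewrite {1}(divn_eq m c) natrD natrM cR mulr0 add0r.
apply/eqP/idP => [m0 | /dvdnP[k ->]]; last by rewrite natrM cR mulr0.
case: (posnP (m %% c)%N) => [/eqP //|mc].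
by have := cmin _ mc; rewrite -mE leqNgt ltn_mod c0 => /(_ m0).
Qed.

End UnitPowers.

Lemma exprD1_prime (S : comPzRingType) p (x : S) :
  prime p -> x *+ p = 0 -> (1 + x) ^+ p = 1 + x ^+ p.
Proof.
move=> pp xp; have p0 := prime_gt0 pp; rewrite addrC exprD1n.
rewrite -(prednK p0) big_ord_recr big_ord_recl /= prednK // bin0 binn expr0.
rewrite big1 ?addr0 // => i _; rewrite /= /bump /= add1n.
have : (p %| 'C(p, i.+1))%N by apply: prime_dvd_bin => //; have := ltn_ord i; lia.
by case/dvdnP => m ->; rewrite exprS mulnC mulrnA -mulrnAl xp mul0r mul0rn.
Qed.

(** * Roots of unity and nilpotents when the unit group is cyclic *)

Section CyclicUnits.

Variables (S : finComPzRingType) (t : units S).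
Hypothesis units_gen : [set: units S] = <[t]>%g.

Lemma comm_invertible (x y : S) : x * y = 1 -> invertible x.
Proof.
by move=> xy; have yx : y * x = 1 by [rewrite mulrC]; apply: invertibleP xy yx.
Qed.

Lemma unit_power (x y : S) : x * y = 1 -> exists k, x = val t ^+ k.
Proof.
move=> xy; have ix := comm_invertible xy.
have : Units ix \in <[t]>%g by rewrite -units_gen inE.
by case/cycleP => k xk; exists k; rewrite -val_unitX -xk.
Qed.

Lemma prime_root_power p (x y : S) : prime p ->
  x ^+ p = 1 -> y ^+ p = 1 -> x != 1 -> exists k, y = x ^+ k.
Proof.
move=> pp xp yp x1.
have inv (z : S) : z ^+ p = 1 -> invertible z.
  by rewrite -(prednK (prime_gt0 pp)) exprS => zp; apply: comm_invertible zp.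
have ox : #[Units (inv x xp)]%g = p.
  by apply: nt_prime_order => //; apply: val_inj; rewrite val_unitX.
have : Units (inv y yp) \in <[Units (inv x xp)]>%g.
  apply: (@cyclic_prime_order _ [set: units S]%G); rewrite ?inE ?ox //.
    by apply/cyclicP; exists t.
  by apply: val_inj; rewrite val_unitX.
by case/cycleP => k /(congr1 val); rewrite val_unitX; exists k.
Qed.

Lemma unique_involution (x y : S) :
  x ^+ 2 = 1 -> y ^+ 2 = 1 -> x != 1 -> y != 1 -> y = x.
Proof.
move=> x2 y2 x1 y1; have [k yk] := @prime_root_power 2 x y isT x2 y2 x1.
move: y1; rewrite {}yk (divn_eq k 2) exprD mulnC exprM x2 expr1n mul1r modn2.
by case: odd; rewrite // expr0 eqxx.
Qed.

(* Otherwise [1 + y ^+ k.+1] has order [p], so [1 + y ^+ k], whose [p]-th power *)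
(* is 1, is a power [1 + y ^+ k.+1 *+ j] of it; multiply by [y].               *)
Lemma nilpotent_step p k (y : S) : prime p -> y *+ p = 0 ->
  (0 < k)%N -> (k.+2 <= p * k)%N -> y ^+ k.+2 = 0 -> y ^+ k.+1 = 0.
Proof.
move=> pp py k0 kp yk2; apply/eqP; apply: contraT => yk1.
have root j : (0 < j)%N -> (k.+2 <= p * j)%N -> (1 + y ^+ j) ^+ p = 1.
  move=> j0 pj; rewrite exprD1_prime //; last first.
    by case: j j0 {pj} => // j _; rewrite exprS -mulrnAl py mul0r.
  by rewrite -exprM mulnC -(subnKC pj) exprD yk2 mul0r addr0.
have nt : 1 + y ^+ k.+1 != 1.
  apply: contra yk1 => /eqP/(congr1 (fun z => z - 1)).
  by rewrite addrC addKr subrr => ->.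
have rk1 : (1 + y ^+ k.+1) ^+ p = 1 by apply: root => //; nia.
have [j] := prime_root_power pp rk1 (root k k0 kp) nt.
have zz : y ^+ k.+1 * y ^+ k.+1 = 0.
  by rewrite -exprD (_ : k.+1 + k.+1 = k.+2 + k)%N ?exprD ?yk2 ?mul0r //; lia.
have -> : (1 + y ^+ k.+1) ^+ j = 1 + y ^+ k.+1 *+ j.
  elim: j => [|j IH]; first by rewrite expr0 mulr0n addr0.
  rewrite exprS {}IH mulrDl mul1r mulrDr mulr1 mulrnAr zz mul0rn addr0.
  by rewrite mulrS -addrA [_ *+ j + _]addrC.
move=> /addrI/(congr1 (fun z => y * z)).
by rewrite mulrnAr -!exprS yk2 mul0rn => /eqP; rewrite (negbTE yk1).
Qed.

(** For p = 2, [nilpotent_step] needs k + 2 <= 2k, that is k >= 2, so the descent stops at exponent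
    3. *)
Lemma nilpotent2 (y : S) m : y *+ 2 = 0 -> y ^+ m = 0 -> y ^+ 3 = 0.
Proof.
move=> y2; elim: m => [|m IH] ym.
  by rewrite -[y ^+ 3]mulr1 -(expr0 y) ym mulr0.
have [m3 | m3] := leqP m.+1 3; first by rewrite -(subnKC m3) exprD ym mul0r.
case: m m3 ym IH => // m m3 ym; apply.
by apply: (nilpotent_step (p := 2)) => //; lia.
Qed.

(** For p = 3 the condition k + 2 <= 3k already holds at k = 1, so the descent reaches exponent
    2. *)
Lemma nilpotent3 (y : S) m : y *+ 3 = 0 -> y ^+ m = 0 -> y ^+ 2 = 0.
Proof.
move=> y3; elim: m => [|m IH] ym.
  by rewrite -[y ^+ 2]mulr1 -(expr0 y) ym mulr0.
have [m3 | m3] := leqP m.+1 2; first by rewrite -(subnKC m3) exprD ym mul0r.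
case: m m3 ym IH => // m m3 ym; apply.
by apply: (nilpotent_step (p := 3)) => //; lia.
Qed.

End CyclicUnits.

(** * Possible characteristics *)

Section UnitCharacteristic.

Variables (S : finComPzRingType) (t : units S).
Hypothesis units_gen : [set: units S] = <[t]>%g.
Hypothesis inv_nat : forall k l : nat, (k * l)%:R = 1 :> S -> (k * k)%:R = 1 :> S.
Variable c : nat.
Hypothesis charS : has_char S c.

Lemma minus1_neq1 : (2 < c)%N -> -1 != 1 :> S.
Proof.
move=> c2; rewrite eq_sym -addr_eq0 -mulr2n (has_char_eq0 _ charS).
by apply/negP => /dvdn_leq; lia.
Qed.

(** Both k and -1 have square 1 in S, and -1 is the only involution, so k is 1 or -1 in S. *)
Lemma char_involution k : (2 < c)%N -> (0 < k)%N -> coprime k c ->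
  (c %| k.-1)%N || (c %| k.+1)%N.
Proof.
move=> c2 k0 kc; have [u uE] := coprimeP c k0 kc.
have k2 : (k%:R : S) ^+ 2 = 1.
  rewrite expr2 -natrM; apply: (inv_nat (l := u.1)).
  have -> : (k * u.1 = 1 + u.2 * c)%N by rewrite -uE; lia.
  by rewrite natrD natrM; case: charS => _ -> _; rewrite mulr0 addr0.
have [k1 | k1] := eqVneq (k%:R : S) 1.
  by rewrite -(has_char_eq0 _ charS) -subn1 natrB // k1 subrr eqxx.
rewrite -[(c %| k.+1)%N](has_char_eq0 _ charS) -natr1.
have n2 : (-1 : S) ^+ 2 = 1 by rewrite sqrrN expr1n.
by rewrite (unique_involution units_gen n2 k2 (minus1_neq1 c2) k1) addNr eqxx orbT.
Qed.

(** For c > 2 it is enough to test one k prime to c: k = 2 for c odd, k = b + 2 for c = 2b with b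
    odd, k = b + 1 for c = 2b with b even. These give c = 3, 6 and 4. *)
Lemma char_central : (0 < c)%N -> c \in [:: 1; 2; 3; 4; 6]%N.
Proof.
move=> c0; have [c2 | c2] := leqP c 2; first by case: c c0 c2 => [|[|[|]]].
have codd := char_involution c2.
have ltn m : (c %| m)%N -> (0 < m)%N -> (c <= m)%N by move=> cm m0; apply: dvdn_leq.
have [oc | ec] := boolP (odd c).
  have cop : coprime 2 c by rewrite coprime2n.
  have /orP[] := codd 2%N isT cop => /ltn /(_ isT) cle; first by lia.
  by case: c c2 oc cle => [|[|[|[|]]]].
have [b cb] : exists b, c = (2 * b)%N by exists c./2; rewrite mul2n even_halfK.
have [ob | eb] := boolP (odd b).
  have cop : coprime b.+2 c.
    rewrite cb coprimeMr coprimen2 /= negbK ob -addn2 coprime_sym /coprime.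
    by rewrite gcdnDl -/(coprime _ _) coprimen2.
  have /orP[] := codd b.+2 isT cop => /ltn /(_ isT) cle.
    lia.
  have [b2 | b3] : b = 2%N \/ b = 3%N by lia.
    by rewrite b2 in ob.
  by rewrite cb b3.
have cop : coprime b.+1 c.
  by rewrite cb coprimeMr coprimen2 /= eb coprimeSn.
have b0 : (0 < b)%N by lia.
have /orP[] := codd b.+1 isT cop => [/ltn /(_ b0)|/ltn /(_ isT)] cle.
  lia.
have b2 : b = 2%N by lia.
by rewrite cb b2.
Qed.

(** If the order were odd, -1, a power of t with square 1, would equal 1. *)
Lemma even_order : (2 < c)%N -> (2 %| #[t]%g)%N.
Proof.
move=> c2; have [|k tk] := @unit_power _ _ units_gen (-1) (-1).
  by rewrite mulrNN mulr1.
rewrite dvdn2; apply: contra (minus1_neq1 c2) => ot.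
rewrite tk -val_unitX; have -> : (t ^+ k = 1)%g; last by [].
apply/eqP; rewrite -order_dvdn -(@Gauss_dvdl _ _ 2) ?coprimen2 // order_dvdn.
by apply/eqP/val_inj; rewrite val_unitX exprM -tk sqrrN expr1n.
Qed.

End UnitCharacteristic.

(** * Bounds on the order of the generator *)

Section UnitOrder.

Variables (S : finComPzRingType) (t : units S).
Hypothesis units_gen : [set: units S] = <[t]>%g.

Variable N : nat.
Hypothesis tN : (val t ^+ 2 + val t + 1) * (1 + val t) ^+ N = 0.

Lemma order_dvd k : val t ^+ k = 1 -> (#[t]%g %| k)%N.
Proof. by move=> tk; rewrite order_dvdn; apply/eqP/val_inj; rewrite val_unitX. Qed.

(** The square of 1 + 2y is 1, so, unless 2 = 0, 1 + 2y is 1 or -1. In the latter case 2y = 2, and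
    multiplying repeatedly by y gives 2 = 2y^m = 0. *)
Lemma nilpotent_two_torsion (y : S) m :
  4%:R = 0 :> S -> y ^+ m = 0 -> y *+ 2 = 0.
Proof.
move=> c4 ym; have n2 : (-1 : S) ^+ 2 = 1 by rewrite sqrrN expr1n.
have y2 : (1 + y *+ 2) ^+ 2 = 1.
  have -> : (1 + y *+ 2) ^+ 2 = 1 + 4%:R * (y + y ^+ 2) by ring.
  by rewrite c4 mul0r addr0.
have [e | ne] := eqVneq (-1 : S) 1.
  by rewrite -mulr_natr mulr2n -{1}e addNr mulr0.
have [e | nty] := eqVneq (1 + y *+ 2) 1.
  by have := congr1 (fun z => z - 1) e; rewrite addrC addKr subrr.
have E := unique_involution units_gen n2 y2 ne nty.
have y22 : y *+ 2 = 2%:R.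
  have -> : y *+ 2 = (1 + y *+ 2) + 1 - 2%:R by ring.
  by rewrite E addNr sub0r -[LHS]addr0 -c4; ring.
have y2m k : y ^+ k *+ 2 = 2%:R.
  by elim: k => [|k IH]; rewrite ?expr0 // exprS -mulrnAr IH mulr_natr.
by rewrite y22 -(y2m m) ym mul0rn.
Qed.

Lemma nilpotent_factor (x : S) : (x ^+ 2 + x + 1) * (1 + x) ^+ N = 0 ->
  ((x ^+ 2 + x + 1) * (1 + x)) ^+ N.+1 = 0.
Proof.
move=> xN; have -> : forall q r : S, (q * r) ^+ N.+1 = q * r ^+ N * (q ^+ N * r).
  by move=> q r; rewrite exprMn !exprS; ring.
by rewrite xN mul0r.
Qed.

(** Since (x - 1)^2 = (x + 1)^2 - 4x, the equation makes y = x^3 - 1 nilpotent. Then 2y = 0 and y^3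
    = 0, which reduces (1 + y)^4 to 1. Characteristic 2 is covered as well. *)
Lemma order_char4 : 4%:R = 0 :> S -> (#[t]%g %| 12)%N.
Proof.
move=> c4; apply: order_dvd; move: (val t) tN => x xN.
pose y := x ^+ 3 - 1.
have ynil : y ^+ (2 * N.+1) = 0.
  rewrite exprM (_ : y ^+ 2 = ((x ^+ 2 + x + 1) * (1 + x)) ^+ 2
                              - 4%:R * ((x ^+ 2 + x + 1) ^+ 2 * x)).
    by rewrite c4 mul0r subr0 exprAC (nilpotent_factor xN) expr0n.
  by rewrite /y; ring.
have y2 := nilpotent_two_torsion c4 ynil; have y3 := nilpotent2 units_gen y2 ynil.
have -> : x ^+ 12 = (1 + y) ^+ 4 by rewrite /y; ring.
have -> : (1 + y) ^+ 4 =
    1 + (y *+ 2) * (2%:R + 3%:R * y) + y ^+ 3 * (4%:R + y) by ring.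
by rewrite y2 y3; ring.
Qed.

(** Modulo 3, x^2 + x + 1 = (x - 1)^2, so y = x^2 - 1 is nilpotent; then 3y = 0 and y^2 = 0 give (1
    + y)^3 = 1. *)
Lemma order_char3 : 3%:R = 0 :> S -> (#[t]%g %| 6)%N.
Proof.
move=> c3; apply: order_dvd; move: (val t) tN => x xN.
pose y := x ^+ 2 - 1.
have ynil : y ^+ N.+2 = 0.
  have -> : y ^+ N.+2 = (x ^+ 2 + x + 1 - 3%:R * x) * (1 + x) ^+ N
                        * ((x - 1) ^+ N * (1 + x) ^+ 2).
    rewrite /y; have -> : x ^+ 2 - 1 = (x - 1) * (1 + x) by ring.
    by rewrite exprMn -(addn2 N) !exprD; ring.
  by rewrite c3 mul0r subr0 xN mul0r.
have y3 : y *+ 3 = 0 by rewrite -mulr_natr c3 mulr0.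
have y2 := nilpotent3 units_gen y3 ynil.
have -> : x ^+ 6 = 1 + y *+ 3 + y ^+ 2 * (3%:R + y) by rewrite /y; ring.
by rewrite y3 y2 mul0r !addr0.
Qed.

(** Modulo 6, 4 and 3 are complementary idempotents: y and z are the components of x^2 - 1 in
    characteristic 3 and of x^3 - 1 in characteristic 2. The only involution -1 is trivial on the
    characteristic 2 component, which therefore has none, and z vanishes altogether. *)
Lemma order_char6 : has_char S 6 -> (#[t]%g %| 6)%N.
Proof.
move=> ch6; have c6 : 6%:R = 0 :> S by case: ch6.
apply: order_dvd; move: (val t) tN => x xN.
pose y := 4%:R * (x ^+ 2 - 1).
have y3 : y *+ 3 = 0.
  have -> : y *+ 3 = 6%:R * (2%:R * (x ^+ 2 - 1)) by rewrite /y; ring.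
  by rewrite c6 mul0r.
have ynil : y ^+ N.+2 = 0.
  have -> : y = (4%:R * (x - 1)) * (1 + x) by rewrite /y; ring.
  have -> : forall a b : S, (a * b) ^+ N.+2 = a ^+ 2 * b ^+ N * (a ^+ N * b ^+ 2).
    by move=> a b; rewrite exprMn !exprS; ring.
  have -> : (4%:R * (x - 1)) ^+ 2 =
      16%:R * (x ^+ 2 + x + 1) - 6%:R * (8%:R * x) by ring.
  by rewrite c6 mul0r subr0 -[16%:R * _ * _]mulrA xN mulr0 mul0r.
have y2 := nilpotent3 units_gen y3 ynil.
pose z := 3%:R * (x ^+ 3 - 1).
have z2 : z *+ 2 = 0.
  have -> : z *+ 2 = 6%:R * (x ^+ 3 - 1) by rewrite /z; ring.
  by rewrite c6 mul0r.
have znil : z ^+ N.+1 = 0.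
  have -> : z = 3%:R * ((x ^+ 2 + x + 1) * (1 + x)) - 6%:R * (x ^+ 2 + x + 1).
    by rewrite /z; ring.
  by rewrite c6 mul0r subr0 exprMn (nilpotent_factor xN) mulr0.
have z3 := nilpotent2 units_gen z2 znil.
have n2 : (-1 : S) ^+ 2 = 1 by rewrite sqrrN expr1n.
have ne : (-1 : S) != 1 by apply: (minus1_neq1 ch6).
have two k : (2%:R : S) ^+ k != 0.
  rewrite -natrX (has_char_eq0 _ ch6); apply/negP => /(dvdn_trans (isT : 3 %| 6)%N).
  by rewrite Euclid_dvdX.
(* Otherwise 1 + w is the involution -1, so w = -2 and w^2 = 4, which is nonzero in characteristic
   6. *)
have sq0 (w : S) : w *+ 2 = 0 -> w ^+ 2 = 0 -> w = 0.
  move=> w2 ww; have w1 : (1 + w) ^+ 2 = 1.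
    by have -> : (1 + w) ^+ 2 = 1 + w *+ 2 + w ^+ 2 by [ring]; rewrite w2 ww !addr0.
  have [e | nw] := eqVneq (1 + w) 1.
    by have := congr1 (fun u => u - 1) e; rewrite addrC addKr subrr.
  have E := unique_involution units_gen n2 w1 ne nw.
  have wE : w = - 2%:R by have -> : w = (1 + w) - 1 by [ring]; rewrite E; ring.
  by move: (two 2); rewrite -ww wE sqrrN eqxx.
have zz : z ^+ 2 = 0.
  apply: sq0; first by rewrite expr2 -mulrnAl z2 mul0r.
  by rewrite -exprM (exprD z 3 1) z3 mul0r.
have z0 := sq0 z z2 zz.
pose u := x ^+ 2 - 1.
have -> : x ^+ 6 = 1 - z * (x ^+ 3 + 1) + y ^+ 2 * u
    + 6%:R * (2%:R * (u + u ^+ 2 - u ^+ 3)) by rewrite /z /y /u; ring.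
by rewrite z0 y2 c6; ring.
Qed.

End UnitOrder.

(** * Units inverted by conjugation *)

Section InvertedGenerator.

Variables (R : finPzRingType) (t y : units R).
Hypotheses (cent_t : 'C[t]%g = <[t]>%g) (tV : (t ^ y)%g = (t^-1)%g).

Let S : finComPzRingType := bicent (val t).
Let T : S := bicent_gen (val t).

Lemma bicent_order : T ^+ #[t]%g = 1.
Proof. by apply: val_inj; rewrite rmorphXn /= -val_unitX expg_order. Qed.

Lemma bicent_invertible : invertible T.
Proof.
apply: (@comm_invertible _ _ (T ^+ #[t]%g.-1)).
by rewrite -exprS prednK ?order_gt0 // bicent_order.
Qed.

Definition bicent_unit : units S := Units bicent_invertible.

(** Viewed in R, a unit of S commutes with t, hence lies in the centralizer <t>. *)
Lemma bicent_unit_power (w v : S) : w * v = 1 ->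
  exists k, w = T ^+ k /\ val w = val (t ^+ k)%g.
Proof.
move=> wv; have vw : v * w = 1 by rewrite mulrC.
have iw : invertible (val w).
  by apply: (@invertibleP _ _ (val v)); rewrite -rmorphM ?wv ?vw.
have : Units iw \in <[t]>%g.
  by rewrite -cent_t; apply/cent1P/val_inj; rewrite /= bicent_comm.
case/cycleP => k /(congr1 val)/= wk; exists k; split => //.
by apply: val_inj; rewrite rmorphXn /= wk val_unitX.
Qed.

Lemma bicent_units_cycle : [set: units S] = <[bicent_unit]>%g.
Proof.
apply/eqP; rewrite eq_sym -subTset; apply/subsetP => u _.
have [k [uk _]] := bicent_unit_power (val_unitVr u).
by apply/cycleP; exists k; apply: val_inj; rewrite val_unitX.
Qed.

Lemma bicent_unit_order : #[bicent_unit]%g = #[t]%g.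
Proof.
apply/eqP; rewrite eqn_dvd; apply/andP; split.
  by rewrite order_dvdn; apply/eqP/val_inj; rewrite val_unitX bicent_order.
rewrite order_dvdn; apply/eqP/val_inj; rewrite val_unitX.
have := congr1 val (congr1 val (expg_order bicent_unit)).
by rewrite val_unitX rmorphXn.
Qed.

Lemma bicent_char c : has_char R c -> has_char S c.
Proof.
case=> c0 cR cmin; split=> // [|m m0 mS].
  by apply: val_inj; rewrite rmorph_nat cR rmorph0.
by apply: cmin => //; rewrite -[m%:R](rmorph_nat (val : S -> R)) mS rmorph0.
Qed.

Let conjy (x : R) := val (y^-1)%g * x * val y.

Lemma conjy_unit (w v : S) : w * v = 1 -> conjy (val w) * val w = 1.
Proof.
case/bicent_unit_power => k [_ ->]; rewrite /conjy.
have : ((t ^+ k) ^ y * t ^+ k = 1)%g by rewrite conjXg tV expgVn mulVg.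
by move/(congr1 val); rewrite conjgE /= !mulrA.
Qed.

(** Conjugation by y fixes the integer k, yet inverts it as a unit of S. *)
Lemma bicent_nat k l : (k * l)%:R = 1 :> S -> (k * k)%:R = 1 :> S.
Proof.
rewrite !natrM => /conjy_unit kk; apply: val_inj.
rewrite rmorphM rmorph1 -[RHS]kk !rmorph_nat /conjy; congr (_ * _).
by rewrite mulr_natr mulrnAl val_unitV.
Qed.

Lemma bicent_equation : exists N, (T ^+ 2 + T + 1) * (1 + T) ^+ N = 0.
Proof.
have [N [N0 /dvdnP[d Nd] ee]] := pow_idempotent (1 + T) (order_gt0 t).
exists N; pose T' := T ^+ #[t]%g.-1.
have TT' : T * T' = 1 by rewrite -exprS prednK ?order_gt0 // bicent_order.
set e := (1 + T) ^+ N in ee *.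
have T'N : T' ^+ N = 1.
  by rewrite /T' -exprM Nd mulnA mulnC exprM bicent_order expr1n.
(* The order of t divides N, so T'^N = 1; hence the conjugation, which sends T to T', fixes e. *)
have eb : (1 + T') ^+ N = e.
  have -> : 1 + T' = T' * (1 + T) by rewrite mulrDr mulr1 [T' * T]mulrC TT' addrC.
  by rewrite exprMn T'N mul1r.
have conjM u v : conjy (u * v) = conjy u * conjy v.
  by rewrite /conjy !mulrA -[_ * val y * _]mulrA val_unitVr mulr1.
have conj1 : conjy 1 = 1 by rewrite /conjy mulr1 val_unitV.
have conjB u v : conjy (u - v) = conjy u - conjy v.
  by rewrite /conjy mulrBr mulrBl.
have conjD u v : conjy (u + v) = conjy u + conjy v.
  by rewrite /conjy mulrDr mulrDl.
have conjX u k : conjy (u ^+ k) = conjy u ^+ k.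
  by elim: k => [|k IH]; rewrite ?expr0 // !exprS conjM IH.
have conjT : conjy (val T) = val T'.
  have tt : val t * conjy (val t) = 1.
    have : (t * t ^ y = 1)%g by rewrite tV mulgV.
    by move=> /(congr1 val); rewrite conjgE /conjy -mulrA.
  have T'T : val T' * val T = 1 by rewrite -rmorphM mulrC TT' rmorph1.
  by rewrite -[LHS]mul1r -T'T -mulrA tt mulr1.
have idemM a b : (a * e + 1 - e) * (b * e + 1 - e) = a * b * e + 1 - e.
  have -> : (a * e + 1 - e) * (b * e + 1 - e) =
     a * b * (e * e) + (a + b) * (e - e * e) + 1 - 2%:R * e + e * e by ring.
  by rewrite ee; ring.
(* On the component cut out by e = (1 + T)^N, the inverse of 1 + T is (1 + T)^(N-1). *)
have wv : ((1 + T) * e + 1 - e) * ((1 + T) ^+ N.-1 * e + 1 - e) = 1.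
  by rewrite idemM -exprS prednK // -/e ee addrC addKr.
have := conjy_unit wv.
have -> : conjy (val ((1 + T) * e + 1 - e)) = val ((1 + T') * e + 1 - e).
  rewrite -[in RHS]eb !rmorphB !rmorphD !rmorphM !rmorphXn !rmorphD !rmorph1.
  by rewrite conjB conjD conjM conjX conjD conj1 conjT.
rewrite -rmorphM -[1 in RHS](rmorph1 (val : S -> R)) => /val_inj.
rewrite idemM => E1.
have E : (1 + T') * (1 + T) * e = e.
  have -> : (1 + T') * (1 + T) * e = ((1 + T') * (1 + T) * e + 1 - e) - 1 + e.
    by ring.
  by rewrite E1 subrr add0r.
(* Multiplying (1 + T')(1 + T)e = e by T turns it into (1 + T)^2 e = T e. *)
have -> : (T ^+ 2 + T + 1) * e =
    T * ((1 + T') * (1 + T) * e - e) + (1 - T * T') * (1 + T) * e by ring.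
by rewrite E TT' !subrr mulr0 !mul0r addr0.
Qed.

End InvertedGenerator.

Lemma inverted_generator_constraints (R : finPzRingType) (t y : units R) c :
    'C[t]%g = <[t]>%g -> (t ^ y)%g = (t^-1)%g -> has_char R c ->
  let n := #[t]%g in
  c = 1%N \/ [\/ c = 2%N /\ (n %| 12)%N, c = 3%N /\ ((2 %| n) && (n %| 6))%N,
    c = 4%N /\ ((2 %| n) && (n %| 12))%N | c = 6%N /\ ((2 %| n) && (n %| 6))%N].
Proof.
move=> Ct tV ch n; have chS := bicent_char t ch.
have gen := bicent_units_cycle Ct.
have [N tN] := bicent_equation Ct tV.
have nat_inv := bicent_nat Ct tV.
have c0 : (0 < c)%N by case: ch.
have on : #[bicent_unit t]%g = n := bicent_unit_order t.
have even c2 := even_order gen chS c2; rewrite on in even.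
have cE := has_char_eq0 c chS; rewrite dvdnn in cE.
have := char_central gen nat_inv chS c0; rewrite !inE => /or4P[|||/orP[]] /eqP c_.
- by constructor 1.
- right; constructor 1; split=> //; rewrite -on; apply: (order_char4 gen tN).
  by apply/eqP; rewrite (has_char_eq0 _ chS) c_.
- right; constructor 2; split=> //; rewrite even ?c_ //= -on.
  apply: (order_char3 gen tN).
  by apply/eqP; rewrite (has_char_eq0 _ chS) c_.
- right; constructor 3; split=> //; rewrite even ?c_ //= -on.
  apply: (order_char4 gen tN).
  by apply/eqP; rewrite (has_char_eq0 _ chS) c_.
right; constructor 4; split=> //; rewrite even ?c_ //= -on.
  apply: (order_char6 gen tN).
by rewrite -c_.
Qed.

Lemma realizes_hol_constraints (R : finPzRingType) c n :
  (0 < n)%N -> realizes_hol R c n ->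
     (c = 1%N /\ n = 1%N)
  \/ (c = 2%N /\ n \in [:: 1; 2; 3; 4; 6; 12]%N)
  \/ (c = 3%N /\ n \in [:: 2; 6]%N)
  \/ (c = 4%N /\ n \in [:: 2; 4; 6; 12]%N)
  \/ (c = 6%N /\ n \in [:: 2; 6]%N).
Proof.
move=> n0 [ch]; rewrite isog_sym => isoR; have := isoR.
have [t [y [ot Ct _ ty]]] := hol_inversion n0.
case/isogP => f injf fG.
have Ct' : 'C[f t]%g = <[f t]>%g.
  apply/eqP; rewrite eqEsubset andbC cycle_subG cent1id /=.
  apply/subsetP => u /cent1P; have : u \in f @* 'Hol_n by rewrite fG inE.
  case/morphimP => h _ _ -> /=.
  rewrite /commute -!morphM ?inE // => /(injmP injf) ht.
  have : h \in <[t]>%g by rewrite -Ct; apply/cent1P/ht; rewrite inE.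
  by case/cycleP => k ->; rewrite morphX ?inE // mem_cycle.
have ty' : (f t ^ f y)%g = ((f t)^-1)%g by rewrite -morphJ ?inE // ty morphV ?inE.
have := inverted_generator_constraints Ct' ty' ch.
rewrite order_injm ?inE // ot /= => -[c1|[[c2 n12]|[c3 n6]|[c4 n12]|[c6 n6]]].
- left; split=> //.
  (* In the zero ring the unit group is trivial, so n times its totient is 1. *)
  have R1 (x z : R) : x = z.
    have one0 : 1 = 0 :> R by case: ch => _; rewrite c1.
    by rewrite -[x]mul1r -[z]mul1r one0 !mul0r.
  have : #|'U(R)| = 1%N.
    apply/eqP/cards1P; exists 1%g; apply/setP => u; rewrite !inE; apply/esym/eqP.
    exact/val_inj/R1.
  by rewrite -(card_isog isoR) card_hol // => /eqP; rewrite muln_eq1 => /andP[/eqP].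
- right; left; split=> //; have := @dvdn_leq n 12 isT n12; move: n12 n0.
  by clear; do 13?case: n => [|n] //.
- do 2 right; left; split=> //; case/andP: n6 => n2 n6.
  have := @dvdn_leq n 6 isT n6; move: n2 n6 n0.
  by clear; do 7?case: n => [|n] //.
- do 3 right; left; split=> //; case/andP: n12 => n2 n12.
  have := @dvdn_leq n 12 isT n12; move: n2 n12 n0.
  by clear; do 13?case: n => [|n] //.
do 4 right; split=> //; case/andP: n6 => n2 n6.
have := @dvdn_leq n 6 isT n6; move: n2 n6 n0.
  by clear; do 7?case: n => [|n] //.
Qed.

(** * Unit groups of concrete rings *)

Section Model.

Variables (R : finPzRingType) (L : eqType) (enc : R -> L).
Variables (cmul : L -> L -> L) (c1 : L) (support : seq L).
Hypothesis enc_inj : injective enc.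
Hypothesis encM : {morph enc : x y / x * y >-> cmul x y}.
Hypothesis enc1 : enc 1 = c1.
Hypothesis enc_support : forall x, enc x \in support.

Definition cunits : seq L :=
  [seq a <- support | has (fun b => (cmul a b == c1) && (cmul b a == c1)) support].

Definition cpow a k := iter k (cmul a) c1.

(* For an involution [b], the relation [a * b * a = b] says that conjugation *)
(* by [b] inverts [a].                                                       *)
Definition dihedral_check q a b :=
  [&& cpow a q == c1, all (fun d => cpow a d != c1) (iota 1 q.-1),
      cmul b b == c1 & cmul (cmul a b) a == b].

(** An upper bound is enough, so [support] may contain repetitions and tuples that encode
    nothing. *)
Lemma card_units_model : (#|'U(R)| <= size cunits)%N.
Proof.
rewrite cardE -(size_map (enc \o val)); apply: uniq_leq_size.
  rewrite map_inj_uniq ?enum_uniq //; exact: inj_comp enc_inj val_inj.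
move=> _ /mapP[u _ ->]; rewrite mem_filter enc_support andbT.
apply/hasP; exists (enc (val (u^-1)%g)) => //=.
by rewrite -!encM val_unitV val_unitVr enc1 eqxx.
Qed.

Lemma encX x k : enc (x ^+ k) = cpow (enc x) k.
Proof. by elim: k => [|k IH]; rewrite ?expr0 // exprS encM IH. Qed.

(** Two explicit units generate a dihedral group of order 2q, and the enumeration shows that there
    are no further units. *)
Lemma units_dihedral_model u v q : (2 < q)%N ->
  (size cunits <= q.*2)%N && dihedral_check q (enc u) (enc v) ->
  'U(R) \isog 'D_(q.*2).
Proof.
move=> q2 /and5P[le_q]; rewrite -encX -!encM -enc1 !(inj_eq enc_inj).
move=> /eqP uq /allP nu /eqP vv /eqP uvu.
have iu : invertible u.
  apply: (@invertibleP _ _ (u ^+ q.-1));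
    by rewrite -?exprS -?exprSr prednK ?uq //; lia.
have iv : invertible v by apply: (@invertibleP _ _ v).
apply: (dihedral_isog q2 (in_setT (Units iu)) (in_setT (Units iv))).
- have q0 : (0 < q)%N by lia.
  have oq : (#[Units iu]%g %| q)%N.
    by rewrite order_dvdn; apply/eqP/val_inj; rewrite val_unitX.
  apply/eqP; rewrite eqn_leq dvdn_leq //= leqNgt; apply/negP => lt_q.
  have := nu #[Units iu]%g; rewrite mem_iota order_gt0 add1n prednK // lt_q.
  move=> /(_ isT); rewrite -encX (inj_eq enc_inj).
  have /(congr1 val) := expg_order (Units iu).
  by rewrite val_unitX /= => ->; rewrite eqxx.
- by apply: val_inj; rewrite val_unitX.
- have UVU : (Units iu * Units iv * Units iu = Units iv)%g by apply: val_inj.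
  have UV : (Units iu * Units iv = Units iv * (Units iu)^-1)%g.
    by rewrite -{2}UVU mulgK.
  by rewrite conjgE UV mulKg.
exact: leq_trans card_units_model le_q.
Qed.

End Model.

(** If some m with 0 < m < p vanished in R, a Bezout relation between m and p would give 1 = 0. *)
Lemma has_char_prime (R : finPzRingType) p :
  prime p -> p%:R = 0 :> R -> 1 != 0 :> R -> has_char R p.
Proof.
move=> pp pR ne; split=> // [|m m0 mR]; first exact: prime_gt0.
rewrite leqNgt; apply/negP => mp; case/eqP: ne.
have cop : coprime m p by rewrite coprime_sym prime_coprime // gtnNdvd.
have [u uE] := coprimeP p m0 cop.
have -> : 1 = (u.1 * m)%:R :> R.
  by rewrite (_ : u.1 * m = 1 + u.2 * p)%N ?natrD ?natrM ?pR ?mulr0 ?addr0 //; lia.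
by rewrite natrM mR mulr0.
Qed.

Lemma has_char_prod (R S : finPzRingType) a b :
  has_char R a -> has_char S b -> has_char (R * S)%type (lcmn a b).
Proof.
move=> ca cb; have [[a0 _ _] [b0 _ _]] := (ca, cb).
have natE m : (m%:R == 0 :> R * S) = (lcmn a b %| m)%N.
  rewrite dvdn_lcm -(has_char_eq0 m ca) -(has_char_eq0 m cb).
  have -> : m%:R = (m%:R, m%:R) :> R * S.
    by elim: m => // m IH; rewrite -natr1 IH -!natr1.
  by rewrite -pair_eqE.
split; first by rewrite lcmn_gt0 a0.
  by apply/eqP; rewrite natE.
by move=> m m0 /eqP; rewrite natE => /dvdn_leq; apply.
Qed.

Section ProductUnits.

Variables R S : finPzRingType.

Lemma invertible_pair (u : units R) (v : units S) :
  invertible ((val u, val v) : R * S).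
Proof.
apply: (@invertibleP _ _ (val (u^-1)%g, val (v^-1)%g)).
  by congr (_, _); apply: val_unitVr.
by congr (_, _); apply: val_unitV.
Qed.

Definition pair_unit (w : units R * units S) : units (R * S)%type :=
  Units (invertible_pair w.1 w.2).

Lemma pair_unitM : {in setX 'U(R) 'U(S) &, {morph pair_unit : x y / (x * y)%g}}.
Proof. by move=> x y _ _; apply: val_inj. Qed.

Canonical pair_unit_morphism := Morphism pair_unitM.

Lemma units_prod_isog : 'U(R * S) \isog setX 'U(R) 'U(S).
Proof.
rewrite isog_sym; apply/isogP; exists pair_unit_morphism.
  apply/injmP => -[x1 x2] [y1 y2] _ _ /(congr1 val)[/val_inj -> /val_inj ->].
  by [].
apply/eqP; rewrite -subTset; apply/subsetP => w _.
have i1 : invertible (val w).1.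
  apply: (@invertibleP _ _ (val (w^-1)%g).1).
    by have := congr1 fst (val_unitVr w).
  by have := congr1 fst (val_unitV w).
have i2 : invertible (val w).2.
  apply: (@invertibleP _ _ (val (w^-1)%g).2).
    by have := congr1 snd (val_unitVr w).
  by have := congr1 snd (val_unitV w).
have -> : w = pair_unit (Units i1, Units i2).
  by apply: val_inj; rewrite /=; case: (val w).
by apply: mem_morphim; rewrite !inE.
Qed.

End ProductUnits.

Lemma isog_setX (aT bT cT dT : finGroupType) (A : {group aT}) (B : {group bT})
    (C : {group cT}) (D : {group dT}) :
  A \isog C -> B \isog D -> setX A B \isog setX C D.
Proof.
move=> AC BD; apply: (isog_dprod (setX_dprod A B) (setX_dprod C D)).
  rewrite isog_sym; apply: isog_trans (isog_setX1 _ _).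
  by rewrite isog_sym; apply: isog_trans AC (isog_setX1 _ _).
rewrite isog_sym; apply: isog_trans (isog_set1X _ _).
by rewrite isog_sym; apply: isog_trans BD (isog_set1X _ _).
Qed.

Lemma isog_setXC (aT bT : finGroupType) (A : {group aT}) (B : {group bT}) :
  setX A B \isog setX B A.
Proof.
have := setX_dprod A B; rewrite dprodC => BA.
apply: (isog_dprod BA (setX_dprod B A)).
  rewrite isog_sym; apply: isog_trans (isog_set1X _ _).
  by rewrite isog_sym isog_setX1.
rewrite isog_sym; apply: isog_trans (isog_setX1 _ _).
by rewrite isog_sym isog_set1X.
Qed.

Lemma isog_prime_card (aT bT : finGroupType) (A : {group aT}) (B : {group bT}) p :
  prime p -> #|A| = p -> #|B| = p -> A \isog B.
Proof.
move=> pp oA oB.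
have cyc (gT : finGroupType) (G : {group gT}) : #|G| = p -> cyclic G.
  by move=> oG; apply: prime_cyclic; rewrite oG.
by rewrite (isog_cyclic_card B (cyc _ _ oA)) (cyc _ _ oB) oA oB eqxx.
Qed.

Lemma isog_card1 (aT bT : finGroupType) (A : {group aT}) (B : {group bT}) :
  #|A| = 1%N -> #|B| = 1%N -> A \isog B.
Proof.
move=> /eqP; rewrite -trivg_card1 => /eqP-> /eqP; rewrite -trivg_card1 => /eqP->.
by rewrite (isog_cyclic_card 1%G (cyclic1 _)) cyclic1 !cards1.
Qed.

Lemma mem_F2 (x : 'F_2) : x \in [:: 0; 1].
Proof. by case: x => [[|[|]]]. Qed.

Lemma mem_F3 (x : 'F_3) : x \in [:: 0; 1; 2%:R].
Proof. by case: x => [[|[|[|]]]]. Qed.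

Lemma mem_Z4 (x : 'Z_4) : x \in [:: 0; 1; 2%:R; 3%:R].
Proof. by case: x => [[|[|[|[|]]]]]. Qed.

Lemma mem_Z6 (x : 'Z_6) : x \in [:: 0; 1; 2%:R; 3%:R; 4%:R; 5%:R].
Proof. by case: x => [[|[|[|[|[|[|]]]]]]]. Qed.

Lemma has_char_Zp n : (1 < n)%N -> has_char 'Z_n n.
Proof.
move=> n1; split=> [||m m0]; first exact: ltnW.
  by apply: val_inj; rewrite /= val_Zp_nat // modnn.
move/(congr1 val); rewrite /= val_Zp_nat // => /eqP.
by move/dvdn_leq; apply.
Qed.

Lemma has_char_Fp p : prime p -> has_char 'F_p p.
Proof.
by move=> pp; have := has_char_Zp (prime_gt1 pp); rewrite -{1 2}(pdiv_id pp).
Qed.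

(** * Full and triangular matrix rings, encoded by tuples of entries *)

Definition cmul2 (K : pzSemiRingType) (A B : K * K * (K * K)) :=
  let: ((a, b), (c, d)) := A in let: ((a', b'), (c', d')) := B in
  ((a * a' + b * c', a * b' + b * d'), (c * a' + d * c', c * b' + d * d')).

Section Matrix2.

Variable K : finNzRingType.

Definition enc2 (A : 'M[K]_2) := ((A 0 0, A 0 1), (A 1 0, A 1 1)).

Lemma ord2_case (P : 'I_2 -> Prop) : P 0 -> P 1 -> forall i, P i.
Proof.
move=> P0 P1 [[|[|i]] //= lti].
  by rewrite (_ : Ordinal lti = 0) //; apply: val_inj.
by rewrite (_ : Ordinal lti = 1) //; apply: val_inj.
Qed.

Lemma sum_ord2 (F : 'I_2 -> K) : \sum_i F i = F 0 + F 1.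
Proof.
by rewrite !big_ord_recl big_ord0 addr0; congr (_ + F _); apply: val_inj.
Qed.

Lemma enc2_inj : injective enc2.
Proof.
move=> A B [e00 e01 e10 e11]; apply/matrixP.
by apply: ord2_case; apply: ord2_case.
Qed.

Lemma enc2M : {morph enc2 : A B / A * B >-> cmul2 A B}.
Proof. by move=> A B; rewrite /enc2 !mxE !sum_ord2. Qed.

Lemma enc2_1 : enc2 1 = ((1, 0), (0, 1)).
Proof. by rewrite /enc2 !mxE. Qed.

Definition dec2 (t : K * K * (K * K)) : 'M[K]_2 :=
  \matrix_(i, j) (if i == 0 then if j == 0 then t.1.1 else t.1.2
                  else if j == 0 then t.2.1 else t.2.2).

Lemma dec2K : cancel dec2 enc2.
Proof. by case=> [[a b] [c d]]; rewrite /enc2 !mxE. Qed.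

Lemma natr_mx2 m : (m%:R : 'M[K]_2) = dec2 ((m%:R, 0), (0, m%:R)).
Proof.
apply: enc2_inj; rewrite dec2K; elim: m => [|m IH]; first by rewrite /enc2 !mxE.
by move: IH; rewrite -!natr1 /enc2 !mxE => -[-> -> -> ->]; rewrite !addr0.
Qed.

Lemma has_char_mx2 p : prime p -> has_char K p -> has_char 'M[K]_2 p.
Proof.
move=> pp [_ pK _]; apply: has_char_prime => //; last exact: oner_neq0.
by rewrite natr_mx2 pK; apply: enc2_inj; rewrite dec2K /enc2 !mxE.
Qed.

End Matrix2.

Definition allF2x4 : seq ('F_2 * 'F_2 * ('F_2 * 'F_2)) :=
  let s := [seq (a, b) | a <- [:: 0; 1], b <- [:: 0; 1]] in
  [seq (x, y) | x <- s, y <- s].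

Lemma mem_F2x4 x : x \in allF2x4.
Proof. by case: x => -[a b] [c d]; do !apply: allpairs_f; apply: mem_F2. Qed.

Lemma units_M2F2 : 'U('M['F_2]_2) \isog 'D_6.
Proof.
(* The companion matrix of X^2 + X + 1, of order 3, and the swap of the basis vectors. *)
apply: (@units_dihedral_model _ _ (@enc2 _) (@cmul2 _) ((1, 0), (0, 1))
         allF2x4 _ _ _ _
         (dec2 ((0, 1), (1, 1))) (dec2 ((0, 1), (1, 0))) 3).
- exact: enc2_inj.
- exact: enc2M.
- exact: enc2_1.
- by move=> x; apply: mem_F2x4.
- by [].
by rewrite !dec2K; vm_compute.
Qed.

Section Upper2.

Variable K : finNzRingType.

Definition encU2 (u : 'U_2[K]) := (val u 0 0, val u 1 1, val u 0 1).

Definition cmulU2 (s t : K * K * K) :=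
  let: (a, d, b) := s in let: (a', d', b') := t in
  (a * a', d * d', a * b' + b * d').

Lemma upper2_10 (u : 'U_2[K]) : val u 1 0 = 0.
Proof. exact: (upperP _ (valP u)). Qed.

Lemma encU2_inj : injective encU2.
Proof.
move=> u v [e00 e11 e01]; apply/val_inj/matrixP.
by apply: ord2_case; apply: ord2_case; rewrite ?upper2_10.
Qed.

Lemma encU2M : {morph encU2 : u v / u * v >-> cmulU2 u v}.
Proof.
move=> u v; rewrite /encU2 (rmorphM (val : 'U_2[K] -> 'M[K]_2)) !mxE !sum_ord2.
by rewrite !upper2_10 mulr0 addr0 mul0r add0r.
Qed.

Lemma encU2_1 : encU2 1 = (1, 1, 0).
Proof. by rewrite /encU2 (rmorph1 (val : 'U_2[K] -> 'M[K]_2)) !mxE. Qed.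

Fact decU2_subproof (t : K * K * K) :
  upper_pred (dec2 ((t.1.1, t.2), (0, t.1.2))).
Proof. by apply/upperP; apply: ord2_case; apply: ord2_case => //; rewrite mxE. Qed.

Definition decU2 t : 'U_2[K] := Upper (decU2_subproof t).

Lemma decU2K : cancel decU2 encU2.
Proof. by case=> [[a d] b]; rewrite /encU2 !mxE. Qed.

End Upper2.

Section Upper3.

Variable K : finNzRingType.

Let o0 : 'I_3 := @Ordinal 3 0 isT.
Let o1 : 'I_3 := @Ordinal 3 1 isT.
Let o2 : 'I_3 := @Ordinal 3 2 isT.

Lemma ord3_case (P : 'I_3 -> Prop) : P o0 -> P o1 -> P o2 -> forall i, P i.
Proof.
move=> P0 P1 P2 [[|[|[|i]]] //= lti].
- by rewrite (_ : Ordinal lti = o0) //; apply: val_inj.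
- by rewrite (_ : Ordinal lti = o1) //; apply: val_inj.
by rewrite (_ : Ordinal lti = o2) //; apply: val_inj.
Qed.

Lemma sum_ord3 (F : 'I_3 -> K) : \sum_i F i = F o0 + F o1 + F o2.
Proof.
rewrite !big_ord_recl big_ord0 addr0 addrA.
by congr (F _ + F _ + F _); apply: val_inj.
Qed.

Definition encU3 (u : 'U_3[K]) :=
  ((val u o0 o0, val u o1 o1, val u o2 o2),
   (val u o0 o1, val u o0 o2, val u o1 o2)).

Definition cmulU3 (s t : K * K * K * (K * K * K)) :=
  let: ((a, b, c), (x, z, y)) := s in let: ((a', b', c'), (x', z', y')) := t in
  ((a * a', b * b', c * c'),
   (a * x' + x * b', a * z' + x * y' + z * c', b * y' + y * c')).

Lemma upper3_lower (u : 'U_3[K]) :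
  (val u o1 o0 = 0) * (val u o2 o0 = 0) * (val u o2 o1 = 0).
Proof. by split; first split; apply: (upperP _ (valP u)). Qed.

Lemma encU3_inj : injective encU3.
Proof.
move=> u v [e00 e11 e22 e01 e02 e12]; apply/val_inj/matrixP.
by apply: ord3_case; apply: ord3_case; rewrite ?upper3_lower.
Qed.

Lemma encU3M : {morph encU3 : u v / u * v >-> cmulU3 u v}.
Proof.
move=> u v; rewrite /encU3 (rmorphM (val : 'U_3[K] -> 'M[K]_3)) !mxE !sum_ord3.
by rewrite !upper3_lower !mulr0 !mul0r !addr0 !add0r.
Qed.

Lemma encU3_1 : encU3 1 = ((1, 1, 1), (0, 0, 0)).
Proof. by rewrite /encU3 (rmorph1 (val : 'U_3[K] -> 'M[K]_3)) !mxE. Qed.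

Definition decU3_mx (t : K * K * K * (K * K * K)) : 'M[K]_3 :=
  let: ((a, b, c), (x, z, y)) := t in
  \matrix_(i, j) nth 0 [:: a; x; z; 0; b; y; 0; 0; c] (3 * i + j).

Fact decU3_subproof t : upper_pred (decU3_mx t).
Proof.
case: t => [[[a b] c] [[x z] y]].
by apply/upperP; apply: ord3_case; apply: ord3_case => //; rewrite mxE.
Qed.

Definition decU3 t : 'U_3[K] := Upper (decU3_subproof t).

Lemma decU3K : cancel decU3 encU3.
Proof. by case=> [[[a b] c] [[x z] y]]; rewrite /encU3 !mxE. Qed.

End Upper3.

Lemma has_char_upper (K : finNzRingType) n p :
  prime p -> has_char K p -> has_char 'U_n.+1[K] p.
Proof.
move=> pp [_ pK _]; apply: has_char_prime => //.
  apply: val_inj; rewrite (rmorph_nat (val : 'U_n.+1[K] -> 'M[K]_n.+1)).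
  by apply/matrixP => i j; rewrite mulmxnE -mulr_natr pK mulr0 mxE.
apply/negP => /eqP/(congr1 (val : 'U_n.+1[K] -> 'M[K]_n.+1)).
rewrite (rmorph1 (val : 'U_n.+1[K] -> 'M[K]_n.+1)) => /matrixP/(_ ord0 ord0)/eqP.
by rewrite !mxE /= oner_eq0.
Qed.

Definition all3 (T : eqType) (s : seq T) : seq (T * T * T) :=
  [seq (x, z) | x <- [seq (x, y) | x <- s, y <- s], z <- s].

Lemma mem_all3 (T : eqType) (s : seq T) :
  (forall x, x \in s) -> forall x, x \in all3 s.
Proof. by move=> sT [[a b] c]; do !apply: allpairs_f. Qed.

Lemma units_U3F2 : 'U('U_3['F_2]) \isog 'D_8.
Proof.
(* A full unipotent Jordan block, of order 4 in characteristic 2, and a transvection. *)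
apply: (@units_dihedral_model _ _ (@encU3 _) (@cmulU3 _) ((1, 1, 1), (0, 0, 0))
         [seq (x, y) | x <- all3 [:: 0; 1], y <- all3 [:: 0; 1]] _ _ _ _
         (decU3 ((1, 1, 1), (1, 0, 1))) (decU3 ((1, 1, 1), (1, 0, 0))) 4).
- exact: encU3_inj.
- exact: encU3M.
- exact: encU3_1.
- by move=> x; case: (encU3 x) => a b; apply: allpairs_f; apply: mem_all3 mem_F2 _.
- by [].
by rewrite !decU3K; vm_compute.
Qed.

Lemma units_U2F3 : 'U('U_2['F_3]) \isog 'D_12.
Proof.
(* Minus a transvection, of order 6, and diag(1, -1), which inverts it. *)
apply: (@units_dihedral_model _ _ (@encU2 _) (@cmulU2 _) (1, 1, 0)
         (all3 [:: 0; 1; 2%:R]) _ _ _ _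
         (decU2 (-1, -1, 1)) (decU2 (1, -1, 0)) 6).
- exact: encU2_inj.
- exact: encU2M.
- exact: encU2_1.
- by move=> x; apply: mem_all3 mem_F3 _.
- by [].
by rewrite !decU2K; vm_compute.
Qed.

(** * The endomorphism ring of Z_4 x Z_2 *)

Section EndoModel.

Let A : finZmodType := ('Z_4 * 'Z_2)%type.

(** The map with prescribed images of the two generators. It is additive only if the second image is
    killed by 2, the condition imposed in [supportE]. *)
Definition apply_endo (p : A * A) (x : 'Z_4 * 'Z_2) : A := p.1 *+ x.1 + p.2 *+ x.2.

Definition encE (u : endo A) : A * A := (val u (1, 0), val u (0, 1)).

Definition cmulE (p q : A * A) : A * A := (apply_endo p q.1, apply_endo p q.2).

Definition supportE : seq (A * A) :=
  let s := [seq (a, b) | a <- [:: 0; 1; 2%:R; 3%:R], b <- [:: 0; 1]] in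
  [seq z <- [seq (x, y) | x <- s, y <- s] | z.2 *+ 2 == 0].

Lemma endoD (u : endo A) : {morph val u : x y / x + y}.
Proof. exact/additiveP/valP. Qed.

Lemma endoMn (u : endo A) x m : val u (x *+ m) = val u x *+ m.
Proof.
elim: m => [|m IH]; last by rewrite !mulrS endoD IH.
by have := endoD u 0 0; rewrite addr0 -[LHS]addr0 => /addrI <-.
Qed.

Lemma endoE (u : endo A) x : val u x = apply_endo (encE u) x.
Proof.
rewrite /apply_endo /= -!endoMn -endoD; congr (val u _).
case: x => a b; apply/eqP; case: a => [[|[|[|[|]]]] //= ha];
  by case: b => [[|[|]] //= hb]; vm_compute.
Qed.

Lemma encE_inj : injective encE.
Proof. by move=> u v uv; apply/val_inj/ffunP => x; rewrite !endoE uv. Qed.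

Lemma encEM : {morph encE : u v / u * v >-> cmulE u v}.
Proof. by move=> u v; rewrite /encE /cmulE -!endoE /= !ffunE. Qed.

Lemma encE_1 : encE 1 = ((1, 0), (0, 1)).
Proof. by rewrite /encE /= !ffunE. Qed.

Lemma mem_supportE u : encE u \in supportE.
Proof.
rewrite mem_filter -endoMn; apply/andP; split.
  (* Zero is written as a multiple so that [endoMn] also shows that its image is 0. *)
  by rewrite (_ : (0, 1) *+ 2 = 0 *+ 0) ?endoMn //; apply/eqP; vm_compute.
by case: (encE u) => -[a b] [c d]; do !apply: allpairs_f; rewrite ?mem_F2 ?mem_Z4.
Qed.

Definition decE_fun (p : A * A) : {ffun A -> A} := [ffun x => apply_endo p x].

Lemma decE_additive (p : A * A) :
  p.1 *+ 4 = 0 -> p.2 *+ 2 = 0 -> additive_pred (decE_fun p).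
Proof.
move=> p4 p2; apply/additiveP => x y; rewrite !ffunE /apply_endo.
have modn m k (z : A) : z *+ k = 0 -> z *+ (m %% k) = z *+ m.
  by move=> zk; rewrite {2}(divn_eq m k) mulrnDr mulnC mulrnA zk mul0rn add0r.
by rewrite /= !(modn _ 4) // !(modn _ 2) // !mulrnDr addrACA.
Qed.

Lemma natr_endo m x : val (m%:R : endo A) x = x *+ m.
Proof.
elim: m => [|m IH]; first by rewrite ffunE.
by rewrite -natr1 mulrSr -IH /= !ffunE.
Qed.

Lemma has_char_endo : has_char (endo A) 4.
Proof.
split=> // [|m m0 /(congr1 (fun u : endo A => val u (1, 0)))].
  apply/val_inj/ffunP => x; rewrite natr_endo ffunE.
  case: x => a b; apply/eqP; case: a => [[|[|[|[|]]]] //= ha];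
    by case: b => [[|[|]] //= hb]; vm_compute.
rewrite natr_endo ffunE => /(congr1 fst).
have -> : (((1, 0) : A) *+ m).1 = m%:R.
  by elim: (m) => // k IH; rewrite !mulrS /= IH.
by have [_ _] := @has_char_Zp 4 isT; apply.
Qed.

Lemma units_endo : 'U(endo A) \isog 'D_8.
Proof.
have dx : additive_pred (decE_fun ((1, 1), (2%:R, 1))).
  by apply: decE_additive; apply/eqP; vm_compute.
have dy : additive_pred (decE_fun ((1, 1), (0, 1))).
  by apply: decE_additive; apply/eqP; vm_compute.
(* The square of the first map is -1 on Z_4 and the identity on Z_2, so that map has order 4. *)
apply: (@units_dihedral_model _ _ encE cmulE ((1, 0), (0, 1)) supportE _ _ _ _
         (Endo dx) (Endo dy) 4).
- exact: encE_inj.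
- exact: encEM.
- exact: encE_1.
- exact: mem_supportE.
- by [].
have encK p (dp : additive_pred (decE_fun p)) :
    encE (Endo dp) = (apply_endo p (1, 0), apply_endo p (0, 1)).
  by rewrite /encE /= !ffunE.
by rewrite !encK; vm_compute.
Qed.

End EndoModel.

(** * Rings with at most two units *)

Lemma card_units2 (R : finPzRingType) (u : R) :
  u * u = 1 -> u != 1 -> (#|'U(R)| <= 2)%N -> #|'U(R)| = 2%N.
Proof.
move=> uu u1 le2; apply/eqP; rewrite eqn_leq le2 cardG_gt1.
apply: contra u1 => /eqP U1.
have : Units (invertibleP uu uu) \in 'U(R) by rewrite inE.
by rewrite U1 => /set1P/(congr1 val)/= ->.
Qed.

Lemma card_units_F2 : #|'U('F_2)| = 1%N.
Proof.
apply/eqP; rewrite eqn_leq cardG_gt0 andbT.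
apply: leq_trans (@card_units_model _ _ id *%R 1 [:: 0; 1] _ _ _ _) _ => //.
by move=> x; apply: mem_F2.
Qed.

Lemma card_units_F3 : #|'U('F_3)| = 2%N.
Proof.
apply: (@card_units2 _ (-1)); rewrite ?mulrNN ?mulr1 //.
apply: leq_trans (@card_units_model _ _ id *%R 1 [:: 0; 1; 2%:R] _ _ _ _) _ => //.
by move=> x; apply: mem_F3.
Qed.

Lemma card_units_Z4 : #|'U('Z_4)| = 2%N.
Proof.
apply: (@card_units2 _ (-1)); rewrite ?mulrNN ?mulr1 //.
apply: leq_trans (@card_units_model _ _ id *%R 1
  [:: 0; 1; 2%:R; 3%:R] _ _ _ _) _ => //.
by move=> x; apply: mem_Z4.
Qed.

Lemma card_units_Z6 : #|'U('Z_6)| = 2%N.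
Proof.
apply: (@card_units2 _ (-1)); rewrite ?mulrNN ?mulr1 //.
apply: leq_trans (@card_units_model _ _ id *%R 1
  [:: 0; 1; 2%:R; 3%:R; 4%:R; 5%:R] _ _ _ _) _ => //.
by move=> x; apply: mem_Z6.
Qed.

Section DualNumbers.

Let h : {poly 'F_2} := 'X^2.
Let Q : finPzRingType := {poly %/ h}.

Definition encQ (p : Q) : 'F_2 * 'F_2 := ((val p)`_0, (val p)`_1).

Definition cmulQ (s t : 'F_2 * 'F_2) := (s.1 * t.1, s.1 * t.2 + s.2 * t.1).

(** The quotient type reduces modulo [mk_monic h], which has to be identified with h. *)
Lemma mk_monicX2 : mk_monic h = 'X^2.
Proof. by rewrite /mk_monic size_polyXn monicXn. Qed.

Lemma coef_modX2 (p : {poly 'F_2}) i :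
  (i < 2)%N -> (Pdiv.Ring.rmodp p (mk_monic h))`_i = p`_i.
Proof.
move=> i2; rewrite mk_monicX2.
rewrite [in RHS](Pdiv.RingMonic.rdivp_eq (monicXn _ 2) p).
by rewrite coefD coefMXn i2 add0r.
Qed.

Lemma encQ_inj : injective encQ.
Proof.
move=> p q [e0 e1]; apply/val_inj/polyP => -[|[|i]] //.
have big (r : Q) : (val r)`_i.+2 = 0.
  by apply: big_coef_npoly; rewrite mk_monicX2 size_polyXn.
by rewrite !big.
Qed.

Lemma encQM : {morph encQ : u v / u * v >-> cmulQ u v}.
Proof.
move=> u v; rewrite /encQ /cmulQ /= !coef_modX2 // !coefM.
by rewrite !big_ord_recl !big_ord0 /= /bump /= !addr0.
Qed.

Lemma encQ_1 : encQ 1 = (1, 0).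
Proof. by rewrite /encQ /= !coefC. Qed.

Lemma encQD : {morph encQ : u v / u + v}.
Proof. by move=> u v; rewrite /encQ /= !coefD. Qed.

Lemma encQ_0 : encQ 0 = (0, 0).
Proof. by rewrite /encQ /= !coef0. Qed.

Lemma natr_dual m : encQ m%:R = (m%:R, 0).
Proof.
elim: m => [|m IH]; first exact: encQ_0.
rewrite -natr1 encQD IH encQ_1 -natr1.
by congr (_, _); rewrite /= addr0.
Qed.

Lemma has_char_dual : has_char Q 2.
Proof.
apply: has_char_prime => //.
  by apply: encQ_inj; rewrite natr_dual encQ_0; apply/eqP; vm_compute.
by apply/eqP => /(congr1 encQ); rewrite encQ_1 encQ_0.
Qed.

Lemma card_units_dual : #|'U(Q)| = 2%N.
Proof.
pose u : Q := 1 + in_qpoly h 'X.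
have encu : encQ u = (1, 1).
  have encX : encQ (in_qpoly h 'X) = (0, 1).
    by rewrite /encQ /= !coef_modX2 // !coefX.
  by rewrite encQD encQ_1 encX; apply/eqP; vm_compute.
apply: (@card_units2 _ u).
- by apply: encQ_inj; rewrite encQM encu encQ_1; apply/eqP; vm_compute.
- by rewrite -(inj_eq encQ_inj) encu encQ_1.
apply: leq_trans (@card_units_model _ _ encQ cmulQ (1, 0)
  [seq (a, b) | a <- [:: 0; 1], b <- [:: 0; 1]] encQ_inj encQM encQ_1 _) _ => //.
by move=> x; apply: allpairs_f; apply: mem_F2.
Qed.

End DualNumbers.

(** * Products with unit group D_12 *)

Lemma units_Z4_M2F2 : 'U('Z_4 * 'M['F_2]_2) \isog 'D_12.
Proof.
pose enc (x : 'Z_4 * 'M['F_2]_2) := (x.1, enc2 x.2).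
(* Pairing -1 with a matrix of order 3 gives order 6; the swap inverts the pair because -1 is its
   own inverse. *)
apply: (@units_dihedral_model _ _ enc (fun s t => (s.1 * t.1, cmul2 s.2 t.2))
         (1, ((1, 0), (0, 1)))
         [seq (x, y) | x <- [:: 0; 1; 2%:R; 3%:R], y <- allF2x4] _ _ _ _
         (-1, dec2 ((0, 1), (1, 1))) (1, dec2 ((0, 1), (1, 0))) 6).
- move=> [a b] [c d] e.
  by rewrite (congr1 fst e : a = c) (enc2_inj (congr1 snd e) : b = d).
- by move=> [a b] [c d]; congr (_, _); apply: enc2M.
- by congr (_, _); apply: enc2_1.
- by case=> a b; apply: allpairs_f; rewrite ?mem_Z4 ?mem_F2x4.
- by [].
by rewrite /enc !dec2K; vm_compute.
Qed.

Lemma units_F2_U2F3 : 'U('F_2 * 'U_2['F_3]) \isog 'D_12.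
Proof.
pose enc (x : 'F_2 * 'U_2['F_3]) := (x.1, encU2 x.2).
apply: (@units_dihedral_model _ _ enc (fun s t => (s.1 * t.1, cmulU2 s.2 t.2))
         (1, (1, 1, 0))
         [seq (x, y) | x <- [:: 0; 1], y <- all3 [:: 0; 1; 2%:R]] _ _ _ _
         (1, decU2 (-1, -1, 1)) (1, decU2 (1, -1, 0)) 6).
- move=> [a b] [c d] e.
  by rewrite (congr1 fst e : a = c) (encU2_inj (congr1 snd e) : b = d).
- by move=> [a b] [c d]; congr (_, _); apply: encU2M.
- by congr (_, _); apply: encU2_1.
- by case=> a b; apply: allpairs_f; [apply: mem_F2 | apply: mem_all3 mem_F3 _].
- by [].
by rewrite /enc !decU2K; vm_compute.
Qed.

(* A rewriting system with six normal forms, for right-associated words. *)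
Lemma dihedral6_words (gT : finGroupType) (r x : gT) :
    (r ^+ 3 = 1 -> x ^+ 2 = 1 -> r ^ x = r^-1 ->
  (x * r = r * (r * x)) * (forall w, x * (r * w) = r * (r * (x * w))) *
  (r * (r * r) = 1) * (forall w, r * (r * (r * w)) = w) *
  (x * x = 1) * (forall w, x * (x * w) = w))%g.
Proof.
move=> r3 x2 rx; have rr : (r * (r * r) = 1)%g by rewrite -r3 !expgS mulg1.
have xx : (x * x = 1)%g by rewrite -x2 !expgS mulg1.
have xr : (x * r = r * (r * x))%g.
  have xV : (x^-1 = x)%g by apply/eqP; rewrite eq_invg_mul xx.
  have rV : (r^-1 = r * r)%g by apply/eqP; rewrite eq_invg_mul rr.
  by rewrite mulgA -rV -rx conjgE xV -!mulgA xx mulg1.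
do !split=> //.
- by move=> w; rewrite mulgA xr -!mulgA.
- by move=> w; rewrite !mulgA -(mulgA r) rr mul1g.
by move=> w; rewrite mulgA xx mul1g.
Qed.

(** * The group ring of D_6 over F_2 *)

Section GroupAlgebraD6.

Let G : finGroupType := ('D_6)%type.

Lemma dihedral6_generators : exists r x : G,
  [/\ r ^+ 3 = 1, x ^+ 2 = 1, r ^ x = r^-1 & <<[set r; x]>> = setT]%g.
Proof.
have := homg_refl [set: 'D_(3.*2)]%G; rewrite Grp_dihedral // => /existsP[[r x]].
rewrite /= !xpair_eqE joing_idl joing_idr.
case/and4P=> [/eqP gen /eqP r3 /eqP x2 /eqP rx].
by exists r, x.
Qed.

Variables r x : G.
Hypotheses (r3 : (r ^+ 3 = 1)%g) (x2 : (x ^+ 2 = 1)%g) (rx : (r ^ x = r^-1)%g).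
Hypothesis genG : (<<[set r; x]>> = [set: G])%g.

Let words := dihedral6_words r3 x2 rx.

Let s : seq G := [:: 1; r; r * r; x; r * x; r * (r * x)]%g.

(** The six words are closed under multiplication, so they form a subgroup containing the
    generators. *)
Lemma mem_D6 g : g \in s.
Proof.
have grp : group_set [set h | h \in s].
  apply/group_setP; split=> [|h k]; first by rewrite inE mem_head.
  have split6 k' : k' \in s -> ([\/ k' = 1, k' = r | k' = r * r]
      \/ [\/ k' = x, k' = r * x | k' = r * (r * x)])%g.
    rewrite !inE => /or4P[/eqP|/eqP|/eqP|/or3P[]/eqP] ->.
    - by left; constructor 1.
    - by left; constructor 2.
    - by left; constructor 3.
    - by right; constructor 1.
    - by right; constructor 2.
    by right; constructor 3.
  rewrite ![_ \in [set _ | _]]inE => /split6[[]->|[]->] /split6[[]->|[]->];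
    by rewrite ?mul1g ?mulg1 -?mulgA ?words ?mulg1 ?words ?mulg1 !inE ?eqxx ?orbT.
have : g \in <<[set r; x]>>%g by rewrite genG inE.
have sub : [set r; x] \subset Group grp.
  by apply/subsetP => h; rewrite !inE => /orP[] /eqP->; rewrite eqxx ?orbT.
by rewrite -gen_subG in sub; move/(subsetP sub); rewrite inE.
Qed.

Lemma uniq_D6 : uniq s.
Proof.
apply/card_uniqP; have -> : #|s| = #|[set: 'D_(3.*2)]|.
  by rewrite cardsT; apply: eq_card => g; rewrite mem_D6.
by rewrite card_dihedral.
Qed.

Let A : finPzRingType := group_algebra 'F_2 G.

Definition encG (f : A) : 'F_2 * 'F_2 * 'F_2 * ('F_2 * 'F_2 * 'F_2) :=
  ((f 1, f r, f (r * r)), (f x, f (r * x), f (r * (r * x))))%g.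

(** Convolution, where the first triple holds the coefficients of r^i and the second those of r^i x;
    as x r^j = r^-j x, exponents to the right of a reflection are subtracted. *)
Definition cmulG (f g : 'F_2 * 'F_2 * 'F_2 * ('F_2 * 'F_2 * 'F_2)) :=
  let: ((a0, a1, a2), (b0, b1, b2)) := f in
  let: ((c0, c1, c2), (d0, d1, d2)) := g in
  ((a0 * c0 + a1 * c2 + a2 * c1 + b0 * d0 + b1 * d1 + b2 * d2,
    a0 * c1 + a1 * c0 + a2 * c2 + b0 * d2 + b1 * d0 + b2 * d1,
    a0 * c2 + a1 * c1 + a2 * c0 + b0 * d1 + b1 * d2 + b2 * d0),
   (a0 * d0 + a1 * d2 + a2 * d1 + b0 * c0 + b1 * c1 + b2 * c2,
    a0 * d1 + a1 * d0 + a2 * d2 + b0 * c2 + b1 * c0 + b2 * c1,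
    a0 * d2 + a1 * d1 + a2 * d0 + b0 * c1 + b1 * c2 + b2 * c0)).

Lemma encG_inj : injective encG.
Proof.
move=> f g [e0 e1 e2 e3 e4 e5]; apply/ffunP => z.
have := mem_D6 z; rewrite !inE.
by case/or4P => [/eqP|/eqP|/eqP|/or3P[]/eqP] ->.
Qed.

Lemma sum_D6 (F : G -> 'F_2) :
  \sum_g F g = F 1%g + F r + F (r * r)%g + F x + F (r * x)%g + F (r * (r * x))%g.
Proof.
transitivity (\sum_(g <- s) F g).
  rewrite -big_enum /=; apply: perm_big; apply: uniq_perm => [||g].
  - exact: enum_uniq.
  - exact: uniq_D6.
  by rewrite mem_enum mem_D6.
by rewrite !big_cons big_nil addr0 !addrA.
Qed.

Lemma encGM : {morph encG : f g / f * g >-> cmulG f g}.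
Proof.
move=> f g; rewrite /encG /cmulG /= !ffunE !sum_D6.
have inv (h k : G) : (h * k = 1)%g -> (h^-1 = k)%g.
  by move=> hk; apply/eqP; rewrite eq_invg_mul hk.
rewrite !invg1 (inv r (r * r)%g) ?words // (inv (r * r)%g r) -?mulgA ?words //.
rewrite (inv x x) ?words // (inv (r * x)%g (r * x)%g) -?mulgA ?words //.
rewrite (inv (r * (r * x))%g (r * (r * x))%g) -?mulgA ?words //.
by rewrite ?mul1g ?mulg1 -?mulgA ?words ?mulg1.
Qed.

Lemma encG_1 : encG 1 = ((1, 0, 0), (0, 0, 0)).
Proof.
have := uniq_D6; rewrite /s /= !inE !negb_or -!andbA.
case/andP=> n1 /and5P[n2 n3 n4 n5 _].
rewrite /encG !ffunE eqxx ![(_ == 1)%g]eq_sym.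
by rewrite !(negbTE n1, negbTE n2, negbTE n3, negbTE n4, negbTE n5).
Qed.

Definition decG (t : 'F_2 * 'F_2 * 'F_2 * ('F_2 * 'F_2 * 'F_2)) : A :=
  let: ((a0, a1, a2), (b0, b1, b2)) := t in
  [ffun g => nth 0 [:: a0; a1; a2; b0; b1; b2] (index g s)].

Lemma decGK : cancel decG encG.
Proof.
case=> [[[a0 a1] a2] [[b0 b1] b2]]; rewrite /encG !ffunE.
have idx i : (i < 6)%N -> index (nth 1%g s i) s = i.
  by move=> i6; apply: index_uniq uniq_D6.
by rewrite (idx 0%N) // (idx 1%N) // (idx 2) // (idx 3) // (idx 4) // (idx 5).
Qed.

Lemma encGD : forall f g, encG (f + g) = encG f + encG g.
Proof. by move=> f g; rewrite /encG !ffunE. Qed.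

Lemma has_char_F2D6_aux : has_char A 2.
Proof.
apply: has_char_prime => //.
  apply: encG_inj; rewrite mulr2n encGD encG_1; rewrite /encG !ffunE.
  by apply/eqP; vm_compute.
by rewrite -(inj_eq encG_inj) encG_1 /encG !ffunE.
Qed.

Lemma units_F2D6_aux : 'U(A) \isog 'D_12.
Proof.
(* With s the sum of all group elements, the first unit is r + s = r(1 + s). Here s is central and
   s^2 = 6s = 0, so 1 + s is a central involution and the product has order 6; x inverts r and fixes
   1 + s. *)
apply: (@units_dihedral_model _ _ encG cmulG ((1, 0, 0), (0, 0, 0))
         [seq (a, b) | a <- all3 [:: 0; 1], b <- all3 [:: 0; 1]] _ _ _ _
         (decG ((1, 0, 1), (1, 1, 1))) (decG ((0, 0, 0), (1, 0, 0))) 6).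
- exact: encG_inj.
- exact: encGM.
- exact: encG_1.
- by move=> f; case: (encG f) => a b; apply: allpairs_f; apply: mem_all3 mem_F2 _.
- by [].
by rewrite !decGK; vm_compute.
Qed.

End GroupAlgebraD6.

Lemma has_char_F2D6 : has_char (group_algebra 'F_2 ('D_6)%type) 2.
Proof.
have [r [x [r3 x2 rx gen]]] := dihedral6_generators.
exact: has_char_F2D6_aux r3 x2 rx gen.
Qed.

Lemma units_F2D6 : 'U(group_algebra 'F_2 ('D_6)%type) \isog 'D_12.
Proof.
have [r [x [r3 x2 rx gen]]] := dihedral6_generators.
exact: units_F2D6_aux r3 x2 rx gen.
Qed.

(** * The zero ring, the small holomorphs and the symmetric group of degree 3 *)

Lemma realizes_unit : realizes_hol unit 1 1.
Proof.
split; first by split.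
apply: isog_card1; last by rewrite card_hol.
apply/eqP/cards1P; exists 1%g; apply/setP => u; rewrite !inE.
by apply/esym/eqP/val_inj; case: (val u).
Qed.

Lemma hol2_isog (gT : finGroupType) (H : {group gT}) : #|H| = 2%N -> H \isog 'Hol_2.
Proof.
by move=> oH; apply: (@isog_prime_card _ _ _ _ 2) => //; rewrite card_hol.
Qed.

Lemma hol3_isog : 'Hol_3 \isog 'D_6. Proof. exact: (@hol_dihedral 3). Qed.
Lemma hol4_isog : 'Hol_4 \isog 'D_8. Proof. exact: (@hol_dihedral 4). Qed.
Lemma hol6_isog : 'Hol_6 \isog 'D_12. Proof. exact: (@hol_dihedral 6). Qed.

(** The product a b of two adjacent transpositions is a 3-cycle, and conjugation by a turns it into
    b a, its inverse. *)
Lemma sym3_isog : [set: 'S_3] \isog 'D_6.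
Proof.
pose o0 : 'I_3 := @Ordinal 3 0 isT; pose o1 : 'I_3 := @Ordinal 3 1 isT.
pose o2 : 'I_3 := @Ordinal 3 2 isT.
have [n01 n12 n02] : [/\ o0 != o1, o1 != o2 & o0 != o2] by [].
pose a := tperm o0 o1; pose b := tperm o1 o2.
have aa : (a * a = 1)%g by apply: tperm2.
pose c := (a * b)%g.
have c0 : c o0 = o2 by rewrite permM !tpermL.
have c1 : c o1 = o0 by rewrite permM tpermR tpermD // eq_sym.
have c2 : c o2 = o1 by rewrite permM (tpermD n02 n12) tpermR.
have ccc : (c * (c * c) = 1)%g.
  by apply/permP; apply: ord3_case; rewrite permM permM perm1 ?(c0, c1, c2).
apply: (@dihedral_isog _ [set: 'S_3]%G c a 3); rewrite ?inE //.
- apply: nt_prime_order => //.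
  by apply/eqP => /permP/(_ o0); rewrite c0 perm1 => e; rewrite e eqxx in n02.
- by rewrite conjgE invMg !tpermV -!mulgA (mulgA a a) aa mul1g.
by rewrite cardsT card_Sn.
Qed.

Close Scope ring_scope.
Close Scope group_scope.

Theorem theorem1p2 :
  (forall n c : nat, (1 <= n)%N -> (1 <= c)%N ->
    (exists R : finPzRingType, realizes_hol R c n) <->
    (   (c = 1%N /\ n = 1%N)
     \/ (c = 2%N /\ n \in [:: 1; 2; 3; 4; 6; 12]%N)
     \/ (c = 3%N /\ n \in [:: 2; 6]%N)
     \/ (c = 4%N /\ n \in [:: 2; 4; 6; 12]%N)
     \/ (c = 6%N /\ n \in [:: 2; 6]%N)))
  /\ (* c = 1 *)
  realizes_hol unit 1 1
  /\ (* c = 2 *)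
  ([/\ realizes_hol 'F_2 2 1,
       realizes_hol {poly %/ ('X^2 : {poly 'F_2})%R} 2 2,
       realizes_hol 'M['F_2]_2 2 3 &
       realizes_hol 'U_3['F_2] 2 4]
   /\
   [/\ realizes_hol (group_algebra 'F_2 'D_6) 2 6 &
       realizes_hol ('U_3['F_2] * 'M['F_2]_2)%type 2 12])
  /\ (* c = 3 *)
  [/\ realizes_hol 'F_3 3 2 &
      realizes_hol 'U_2['F_3] 3 6]
  /\ (* c = 4 *)
  [/\ realizes_hol 'Z_4 4 2,
      realizes_hol (endo ('Z_4 * 'Z_2)%type) 4 4,
      realizes_hol ('Z_4 * 'M['F_2]_2)%type 4 6 &
      realizes_hol ('M['F_2]_2 * endo ('Z_4 * 'Z_2)%type)%type 4 12]
  /\ (* c = 6 *)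
  [/\ realizes_hol 'Z_6 6 2 &
      realizes_hol ('F_2 * 'U_2['F_3])%type 6 6]
  /\ (* identification of the holomorphs *)
  [/\ ('Hol_1 \isog Zp 1)%g, ('Hol_2 \isog Zp 2)%g &
      ('Hol_3 \isog [set: 'S_3])%g /\ ([set: 'S_3] \isog 'D_6)%g]
  /\
  [/\ ('Hol_4 \isog 'D_8)%g, ('Hol_6 \isog 'D_12)%g &
      ('Hol_12 \isog setX 'D_8 'D_6)%g].
Proof.
have h2 := @hol2_isog; have h3 := hol3_isog; have h4 := hol4_isog.
have h6 := hol6_isog; have h12 := hol12_isog.
have F2 := @has_char_Fp 2 isT; have F3 := @has_char_Fp 3 isT.
have Z4 := @has_char_Zp 4 isT; have Z6 := @has_char_Zp 6 isT.
have M2 := @has_char_mx2 'F_2 2 isT F2.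
have U3 := @has_char_upper 'F_2 2 2 isT F2.
have U2 := @has_char_upper 'F_3 1 3 isT F3.
have e2_1 : realizes_hol 'F_2 2 1.
  split=> //; apply: isog_card1; [exact: card_units_F2 | by rewrite card_hol].
have e2_2 : realizes_hol {poly %/ ('X^2 : {poly 'F_2})%R} 2 2.
  split; [exact: has_char_dual | exact/h2/card_units_dual].
have e2_3 : realizes_hol 'M['F_2]_2 2 3.
  by split=> //; apply: isog_trans units_M2F2 _; rewrite isog_sym.
have e2_4 : realizes_hol 'U_3['F_2] 2 4.
  by split=> //; apply: isog_trans units_U3F2 _; rewrite isog_sym.
have e2_6 : realizes_hol (group_algebra 'F_2 'D_6) 2 6.
  split; first exact: has_char_F2D6.
  apply: isog_trans units_F2D6 _; rewrite isog_sym; exact: h6.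
have e2_12 : realizes_hol ('U_3['F_2] * 'M['F_2]_2)%type 2 12.
  split; first exact: has_char_prod U3 M2.
  apply: isog_trans (units_prod_isog _ _) _.
  apply: isog_trans (isog_setX units_U3F2 units_M2F2) _.
  rewrite isog_sym; exact: h12.
have e3_2 : realizes_hol 'F_3 3 2 by split; [exact: F3 | exact/h2/card_units_F3].
have e3_6 : realizes_hol 'U_2['F_3] 3 6.
  by split=> //; apply: isog_trans units_U2F3 _; rewrite isog_sym.
have e4_2 : realizes_hol 'Z_4 4 2 by split; [exact: Z4 | exact/h2/card_units_Z4].
have e4_4 : realizes_hol (endo ('Z_4 * 'Z_2)%type) 4 4.
  split; first exact: has_char_endo.
  apply: isog_trans units_endo _; rewrite isog_sym; exact: h4.
have e4_6 : realizes_hol ('Z_4 * 'M['F_2]_2)%type 4 6.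
  split; first exact: has_char_prod Z4 M2.
  by apply: isog_trans units_Z4_M2F2 _; rewrite isog_sym.
have e4_12 : realizes_hol ('M['F_2]_2 * endo ('Z_4 * 'Z_2)%type)%type 4 12.
  split; first exact: has_char_prod M2 has_char_endo.
  apply: isog_trans (units_prod_isog _ _) _.
  apply: isog_trans (isog_setX units_M2F2 units_endo) _.
  (* The factors come in the opposite order to those of [hol12_isog]. *)
  by apply: isog_trans (isog_setXC _ _) _; rewrite isog_sym.
have e6_2 : realizes_hol 'Z_6 6 2 by split; [exact: Z6 | exact/h2/card_units_Z6].
have e6_6 : realizes_hol ('F_2 * 'U_2['F_3])%type 6 6.
  split; first exact: has_char_prod F2 U2.
  by apply: isog_trans units_F2_U2F3 _; rewrite isog_sym.
have e1 := realizes_unit.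
split.
  move=> n c n0 c0; split=> [[R]|]; first exact: realizes_hol_constraints.
  case=> [[-> ->]|Hcn]; first by exists unit.
  (* For each admissible pair the ring is found among the examples established above. *)
  by case: Hcn => [[->]|[[->]|[[->]|[->]]]]; rewrite !inE;
    do ?case/orP; move/eqP->; eexists; eassumption.
do !split=> //.
- by apply: isog_card1; rewrite ?card_hol // card_Zp.
- by rewrite isog_sym; apply: h2; rewrite card_Zp.
- by apply: isog_trans h3 _; rewrite isog_sym; apply: sym3_isog.
exact: sym3_isog.
Qed.
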